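(* Let $n\ge2$, let $u$ be a harmonic polynomial on $\mathbb R^n$, not identically zero, and let $v$ be an entire harmonic function in $\mathbb R^n$ such that $Z(u)\subseteq Z(v)$. Suppose that there exist $\gamma\ge0$ and $C>0$ such that $$\left|\frac{v}{u}\right|(x)\le C(1+|x|)^{\gamma}\quad\text{in }\mathbb R^n$$ (that is, at every $x\in\mathbb R^n\setminus Z(u)$). Then the ratio $v/u$ is a polynomial of degree at most $\lfloor\gamma\rfloor$.
   Context: For a function $f$ on $\mathbb R^n$, $Z(f)=\{x\in\mathbb R^n: f(x)=0\}$. That $v/u$ is a polynomial means that there is a polynomial $R$ with $v=uR$ on $\mathbb R^n$. *)

(* Defs.v *)
From HB Require Import structures.
From mathcomp Require Import all_boot all_order all_algebra.
(* The notations of mpoly clash with those of MathComp-Analysis. *)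
From mathcomp Require Import -(notations) mpoly.
From mathcomp Require Import all_classical all_reals all_analysis.

Set Implicit Arguments.
Unset Strict Implicit.
Unset Printing Implicit Defensive.

Import Order.TTheory GRing.Theory Num.Theory.
Import numFieldNormedType.Exports.
Local Open Scope classical_set_scope.
Local Open Scope ring_scope.

(* The library norm on 'rV[R]_n is the sup norm; it defines the same topology
   as this one. *)
Definition euclidean_norm (R : realType) (n : nat) (x : 'rV[R]_n) : R :=
  Num.sqrt (\sum_(i < n) x ord0 i ^+ 2).

Definition partial (R : realType) (n : nat) (i : 'I_n) (f : 'rV[R]_n -> R) :
    'rV[R]_n -> R :=
  fun x => 'D_(delta_mx ord0 i) f x.

Fixpoint Ck (R : realType) (n k : nat) (f : 'rV[R]_n -> R) : Prop :=
  continuous f /\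
  match k with
  | 0 => True
  | k'.+1 => forall i : 'I_n,
      (forall x, derivable f x (delta_mx ord0 i)) /\ Ck k' (partial i f)
  end.

Definition laplacian (R : realType) (n : nat) (f : 'rV[R]_n -> R) :
    'rV[R]_n -> R :=
  fun x => \sum_(i < n) partial i (partial i f) x.

Definition is_harmonic (R : realType) (n : nat) (f : 'rV[R]_n -> R) : Prop :=
  Ck 2 f /\ forall x, laplacian f x = 0.

Definition mpoly_fun (R : realType) (n : nat) (p : mpoly.mpoly n R) :
    'rV[R]_n -> R :=
  fun x => mpoly.meval (fun i => x ord0 i) p.

Definition zero_set (R : realType) (n : nat) (f : 'rV[R]_n -> R) :
    set 'rV[R]_n :=
  [set x | f x = 0].

(* mpoly.msize r is one more than the total degree of r, and 0 for r = 0, so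
   the degree of the zero polynomial is bounded by every natural number. *)
Definition is_polynomial_ratio (R : realType) (n : nat)
    (v u : 'rV[R]_n -> R) (d : int) : Prop :=
  exists r : mpoly.mpoly n R,
    (forall x, v x = u x * mpoly_fun r x) /\
    (mpoly.msize r)%:Z <= d + 1.

(* Main.v *)
(* Write L for the Laplacian. The growth hypothesis makes v polynomially
   bounded. Comparing v with its reflection in a hyperplane x_i = a, against an
   explicit quadratic barrier on half a cube, bounds differences of a harmonic
   function by its supremum; hence each difference in a coordinate direction
   lowers the growth exponent by one, high differences vanish, and by Frechet's
   functional equation and Lagrange interpolation v is a polynomial.

   For the divisibility, choose e with nonzero top form of u at e, so that
   U(x, t) = u(x + t e) has constant leading coefficient in t. In the ideal of
   the F(x, t) with |F| <= H |U| for some polynomial H, an element of least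
   t-degree is, by Gauss's lemma along lines, a multiple b(x) G of a polynomial
   G monic in t, which divides U and v(x + t e). If U = H G with H not constant
   in t, then H(x, .) has no real root when b(x) <> 0, so H has a constant sign
   and u = h g with g of degree less than u and u g of constant sign.

   This is impossible: L^k (u g) = 0 for k > deg g, and (1 - a L)^-1 preserves
   nonnegativity, so some L^j of the top form of u g would be a nonzero
   nonnegative harmonic form of positive degree; testing such a form against
   squares of linear forms shows that it is convex, hence affine, hence 0. *)

Require Import Defs.
From HB Require Import structures.
From mathcomp Require Import all_boot all_order all_algebra.
From mathcomp Require Import all_classical all_reals all_analysis.
From mathcomp Require mpoly.
From mathcomp Require Import -(notations) mpoly.
From mathcomp Require Import polyrcf complex.
From mathcomp Require Import ring lra zify.

Set Implicit Arguments.
Unset Strict Implicit.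
Unset Printing Implicit Defensive.

Import Order.TTheory GRing.Theory Num.Theory.
Import numFieldNormedType.Exports.
Local Open Scope classical_set_scope.
Local Open Scope ring_scope.

Local Notation var i := (mpolyX _ (mnm1 i)).

(** * Evaluation and restriction to lines *)

Lemma mpoly_rmorph_ext (R : nzRingType) (n : nat) (S : comNzRingType)
    (f g : {rmorphism mpoly n R -> S}) :
  (forall c, f (mpolyC n c) = g (mpolyC n c)) ->
  (forall i, f (var i) = g (var i)) -> f =1 g.
Proof.
move=> fgC fgX p; rewrite [p]mpolyE !raddf_sum; apply: eq_bigr => m _ /=.
rewrite -mul_mpolyC !rmorphM fgC mpolyXE_id !rmorph_prod; congr (_ * _).
by apply: eq_bigr => i _; rewrite !rmorphXn /= fgX.
Qed.

Section Eval.
Variables (R : realType) (n : nat).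
Implicit Types (x e : 'rV[R]_n) (p q : mpoly n R).

(** This is [mpoly_fun] with its arguments exchanged, so that evaluation at a fixed point is a ring
    morphism. *)
Definition mev x : mpoly n R -> R := meval (x ord0).

HB.instance Definition _ x := GRing.RMorphism.copy (mev x) (mev x).

Lemma mevX x i : mev x (var i) = x ord0 i.
Proof. exact: mevalXU. Qed.

Lemma mevC x c : mev x (mpolyC n c) = c.
Proof. exact: mevalC. Qed.

Fact shiftp_key : unit. Proof. by []. Qed.

(* [shiftp e p] is [p (x + t e)], as a polynomial in [t]; it is locked because
   conversion tests between such polynomials diverge. *)
Definition shiftp e : mpoly n R -> {poly mpoly n R} := locked_with shiftp_key
  (mmap (polyC \o @mpolyC n R)
    (fun i => (var i)%:P + (mpolyC n (e ord0 i))%:P * 'X)).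

Fact shiftp_zmod_morphism e : zmod_morphism (shiftp e).
Proof. by rewrite /shiftp locked_withE; exact: raddfB. Qed.

Fact shiftp_monoid_morphism e : monoid_morphism (shiftp e).
Proof. by rewrite /shiftp locked_withE; split;
  [exact: rmorph1|exact: rmorphM]. Qed.

HB.instance Definition _ e :=
  GRing.isZmodMorphism.Build _ _ (shiftp e) (shiftp_zmod_morphism e).
HB.instance Definition _ e :=
  GRing.isMonoidMorphism.Build _ _ (shiftp e) (shiftp_monoid_morphism e).

Lemma shiftpC e c : shiftp e (mpolyC n c) = (mpolyC n c)%:P.
Proof. by rewrite /shiftp locked_withE; exact: mmapC. Qed.

Lemma shiftpX e i :
  shiftp e (var i) = (var i)%:P + (mpolyC n (e ord0 i))%:P * 'X.
Proof. by rewrite /shiftp locked_withE mmapX mmap1U. Qed.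

Definition evp x : {poly mpoly n R} -> {poly R} := map_poly (mev x).

HB.instance Definition _ x := GRing.RMorphism.copy (evp x) (evp x).

(** Both sides are ring morphisms in [p], so it is enough to compare them on constants and
    variables. *)
Lemma evp_shiftp x e p t : (evp x (shiftp e p)).[t] = mev (x + t *: e) p.
Proof.
pose f := horner_eval t \o evp x \o shiftp e.
apply: (@mpoly_rmorph_ext _ _ _ f (mev (x + t *: e))) => [c|i]; rewrite /f /=.
  by rewrite shiftpC /evp map_polyC /= /horner_eval hornerC !mevC.
rewrite shiftpX rmorphD rmorphM /= /evp !map_polyC /= map_polyX /horner_eval.
by rewrite hornerD hornerM !hornerC hornerX /= !mevX mevC !mxE mulrC.
Qed.
End Eval.

Lemma mpoly_ring_ind (R : nzRingType) (n : nat) (P : mpoly n R -> Prop) :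
  (forall c, P (mpolyC n c)) -> (forall i, P (var i)) ->
  (forall p q, P p -> P q -> P (p + q)) ->
  (forall p q, P p -> P q -> P (p * q)) -> forall p, P p.
Proof.
move=> PC PX PD PM p; rewrite [p]mpolyE; apply: big_ind => //.
  by rewrite -mpolyC0; exact: PC.
move=> m _; rewrite -mul_mpolyC; apply: (PM) => //; rewrite mpolyXE_id.
apply: big_ind => [|p' q'|i _]; first by rewrite -mpolyC1; exact: PC.
  exact: PM.
by elim: (m i) => [|k IHk]; rewrite ?expr0 -?mpolyC1 // exprS; exact: PM.
Qed.

(** * Derivatives of polynomial functions, and polynomials determined by their values *)

Section Derivatives.
Variables (R : realType) (n : nat).
Implicit Types (x e : 'rV[R]_n) (p q : mpoly n R).

Lemma mderivXU (i j : 'I_n) : mderiv i (var j : mpoly n R) = (j == i)%:R.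
Proof.
rewrite mderivX mnm1E.
have [->|ij] := eqVneq j i; last by rewrite /= scale0r.
have -> : mnm_sub (mnm1 i) (mnm1 i) = mnm0.
  by apply/mnmP => k; rewrite mnmBE mnm0E subnn.
by rewrite /= mpolyX0 scale1r.
Qed.

Lemma is_derive_coord x e (i : 'I_n) :
  is_derive x e (fun y : 'rV[R]_n => y ord0 i) (e ord0 i).
Proof.
have did : derivable (@id 'rV[R]_n) x e by exact: derivable_id.
apply: DeriveDef; first exact: ((derivable_mxP _ _ _).1 did).
by have := derive_mx did; rewrite derive_id => /matrixP /(_ ord0 i);
  rewrite mxE.
Qed.

Lemma is_derive_mev (i : 'I_n) x p :
  is_derive x (delta_mx ord0 i) (fun y => mev y p) (mev x (mderiv i p)).
Proof.
pose P p := forall x,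
  is_derive x (delta_mx ord0 i) (fun y => mev y p) (mev x (mderiv i p)).
suff : P p by apply.
elim/mpoly_ring_ind: p => {x} [c|j|p q Pp Pq|p q Pp Pq] x.
- rewrite mderivC rmorph0.
  have -> : (fun y => mev y (mpolyC n c)) = cst c.
    by apply/funext => y; rewrite mevC.
  exact: is_derive_cst.
- have -> : (fun y => mev y (var j)) = (fun y : 'rV[R]_n => y ord0 j).
    by apply/funext => y; rewrite mevX.
  apply: is_derive_eq (is_derive_coord x _ j) _.
  by rewrite !mxE eqxx /= mderivXU rmorph_nat.
- have -> : (fun y => mev y (p + q)) = (fun y => mev y p) + (fun y => mev y q).
    by apply/funext => y; rewrite rmorphD.
  by rewrite mderivD rmorphD; exact: (is_deriveD (Pp x) (Pq x)).
- have -> : (fun y => mev y (p * q)) = (fun y => mev y p) * (fun y => mev y q).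
    by apply/funext => y; rewrite rmorphM.
  apply: is_derive_eq (is_deriveM (Pp x) (Pq x)) _.
  by rewrite mderivM rmorphD !rmorphM /= addrC [X in X + _ = _]mulrC.
Qed.

Lemma continuous_mev p : continuous (fun y => mev y p).
Proof.
elim/mpoly_ring_ind: p => [c|j|p q Pp Pq|p q Pp Pq] x.
- have -> : (fun y => mev y (mpolyC n c)) = cst c.
    by apply/funext => y; rewrite mevC.
  exact: cst_continuous.
- have -> : (fun y => mev y (var j)) = (fun y : 'rV[R]_n => y ord0 j).
    by apply/funext => y; rewrite mevX.
  exact: coord_continuous.
- have -> : (fun y => mev y (p + q)) = (fun y => mev y p) + (fun y => mev y q).
    by apply/funext => y; rewrite rmorphD.
  by apply: continuousD; [exact: Pp|exact: Pq].
- have -> : (fun y => mev y (p * q)) = (fun y => mev y p) * (fun y => mev y q).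
    by apply/funext => y; rewrite rmorphM.
  by apply: continuousM; [exact: Pp|exact: Pq].
Qed.

Lemma mev0 p : mev 0 p = mcoeff mnm0 p.
Proof.
apply: (mpoly_rmorph_ext (f := mev 0) (g := mcoeff mnm0)) => [c|i].
  by rewrite /= mevC mcoeffC eqxx mulr1.
by rewrite /= mevX mxE mcoeffX mnm1_eq0.
Qed.

(** Induction on the degree of the monomial: its coefficient is, up to a nonzero integer, a
    coefficient of lower degree in a partial derivative, which also vanishes everywhere. The
    constant coefficient is the value at 0. *)
Lemma mev_eq0 p : (forall x, mev x p = 0) -> p = 0.
Proof.
move=> p0; apply/mpolyP => m; rewrite mcoeff0.
have [k] := ubnP (mdeg m); elim: k => // k IHk in m p p0 * => /ltnSE mk.
have [->|/eqP m0] := eqVneq m mnm0; first by rewrite -mev0.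
have [i mi] : exists i, m i != 0%N.
  apply/existsP; apply: contra_notT m0 => /existsPn m0.
  by apply/mnmP => i; rewrite mnm0E; apply/eqP; rewrite -[_ == _]negbK.
have mE : mnm_add (mnm_sub m (mnm1 i)) (mnm1 i) = m.
  by rewrite submK // lep1mP.
have := IHk (mnm_sub m (mnm1 i)) (mderiv i p).
rewrite mcoeff_deriv mE => /(_ _ _)/eqP; rewrite mulrn_eq0 /= => H.
apply/eqP/H => [x|]; last first.
  by move: mk; rewrite -[in X in X -> _]mE mdegD mdeg1 addn1; exact.
have := @derive_val _ _ _ _ _ _ _ (is_derive_mev i x p).
have -> : (fun y => mev y p) = cst 0 by apply/funext => y; rewrite p0.
by rewrite derive_cst.
Qed.

Lemma mev_inj p q : (forall x, mev x p = mev x q) -> p = q.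
Proof.
move=> pq; apply/eqP; rewrite -subr_eq0; apply/eqP/mev_eq0 => x.
by rewrite rmorphB /= pq subrr.
Qed.

Lemma mev_neq0 p : p != 0 -> exists x, mev x p != 0.
Proof.
move=> p0; apply: contrapT => /forallNP H; move/eqP: p0; apply; apply: mev_eq0.
by move=> x; apply/eqP/negPn/negP; exact: H.
Qed.

Lemma poly_inj_horner (p q : {poly R}) : (forall t, p.[t] = q.[t]) -> p = q.
Proof.
move=> pq; apply/eqP; rewrite -subr_eq0; apply/eqP.
apply: (@roots_geq_poly_eq0 _ _ [seq i%:R | i <- iota 0 (size (p - q)).+1]).
- by apply/allP => x _; rewrite rootE !hornerE pq subrr.
- by rewrite map_inj_uniq ?iota_uniq // => i j /eqP; rewrite eqr_nat => /eqP.
- by rewrite size_map size_iota.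
Qed.

Lemma evp_inj (P Q : {poly mpoly n R}) :
  (forall x t, (evp x P).[t] = (evp x Q).[t]) -> P = Q.
Proof.
move=> PQ; apply/polyP => k; apply: mev_inj => x.
by have /polyP/(_ k) := poly_inj_horner (PQ x); rewrite !coef_map.
Qed.
End Derivatives.

(** * Top forms and degrees along lines *)

Section TopForm.
Variables (R : realType) (n : nat).
Implicit Types (x e : 'rV[R]_n) (p q : mpoly n R).

(** Since [mmeasure mdeg p] is one more than the total degree, this is the homogeneous part of
    highest degree, and 0 for [p = 0]. *)
Definition top p : mpoly n R :=
  \sum_(m <- msupp p | mdeg m == (mmeasure mdeg p).-1)
     mcoeff m p *: mpolyX R m.

Lemma mcoeff_top p m :
  mcoeff m (top p) = if mdeg m == (mmeasure mdeg p).-1 then mcoeff m p else 0.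
Proof.
rewrite /top raddf_sum /=.
have [mp|mp] := boolP (m \in msupp p); last first.
  rewrite (memN_msupp_eq0 mp) if_same big_seq_cond big1 // => m' /andP[m'p _].
  rewrite mcoeffZ mcoeffX; case: eqP => [m'm|]; last by rewrite mulr0.
  by rewrite -m'm m'p in mp.
rewrite big_mkcond (bigD1_seq m) ?msupp_uniq //= big1 ?addr0 =>
  [|m' /negbTE m'm].
  by rewrite mcoeffZ mcoeffX eqxx mulr1.
by rewrite mcoeffZ mcoeffX m'm mulr0 if_same.
Qed.

Lemma top_neq0 p : p != 0 -> top p != 0.
Proof.
move=> p0; apply: contraNneq p0 => /mpolyP /(_ (mlead p)).
have [->//|p0] := eqVneq p 0.
rewrite mcoeff_top -mlead_deg //= eqxx mcoeff0 => /eqP.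
by rewrite mleadc_eq0 (negbTE p0).
Qed.

(** Here [d] only bounds the degree and [c] may be 0; in this form the pair is multiplicative
    without any nonvanishing condition. *)
Let topcoef d c (P : {poly mpoly n R}) :=
  (size P <= d.+1)%N /\ P`_d = mpolyC n c.

Let topcoefM d c d' c' P P' : topcoef d c P -> topcoef d' c' P' ->
  topcoef (d + d') (c * c') (P * P').
Proof.
move=> [sP cP] [sP' cP']; split.
  by apply: leq_trans (size_polyMleq _ _) _; lia.
have dlt : (d < (d + d').+1)%N by lia.
rewrite coefM (bigD1 (Ordinal dlt)) //= addKn cP cP' -mpolyCM big1 ?addr0 //.
move=> j; rewrite -val_eqE /= => jd; case: (ltngtP j d) jd => // jd _.
  by rewrite [P'`_ _]nth_default ?mulr0 //; apply: leq_trans sP' _; lia.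
by rewrite nth_default ?mul0r //; apply: leq_trans sP _.
Qed.

Let topcoef_monomial e m :
  topcoef (mdeg m) (\prod_i e ord0 i ^+ m i) (shiftp e (mpolyX R m)).
Proof.
rewrite mpolyXE_id rmorph_prod mdegE /=.
have tX i : topcoef (m i) (e ord0 i ^+ m i) (shiftp e (var i ^+ m i)).
  rewrite rmorphXn /=; elim: (m i) => [|k IHk].
    by rewrite !expr0; split; rewrite ?size_poly1 // coef1 mpolyC1.
  rewrite !exprS; apply: (topcoefM (d := 1) (c := e ord0 i)) => //.
  split; last by rewrite shiftpX coefD coefC mulrC coefXM coefC add0r.
  rewrite shiftpX; apply: leq_trans (size_polyD _ _) _.
  rewrite geq_max (leq_trans (size_polyC_leq1 _)) //=.
  by apply: leq_trans (size_polyMleq _ _) _;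
    rewrite size_polyX addn2 ltnS size_polyC_leq1.
elim/big_rec3: _ => [|i d c P _ IH].
  by split; rewrite ?size_poly1 // coef1 mpolyC1.
exact: topcoefM (tX i) IH.
Qed.

Lemma shiftp_size e p : (size (shiftp e p) <= mmeasure mdeg p)%N.
Proof.
rewrite {1}[p]mpolyE rmorph_sum /= big_seq.
apply: leq_trans (size_sum _ _ _) _; apply/bigmax_leqP_seq => m mp _.
rewrite -mul_mpolyC rmorphM /= shiftpC mul_polyC;
  apply: leq_trans (size_scale_leq _ _) _.
exact: leq_trans (topcoef_monomial e m).1 (msize_mdeg_lt mp).
Qed.

Lemma shiftp_top e p :
  (shiftp e p)`_(mmeasure mdeg p).-1 = mpolyC n (mev e (top p)).
Proof.
rewrite {1}[p]mpolyE rmorph_sum /= coef_sum /top (rmorph_sum (mev e))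
  (raddf_sum (@mpolyC n R)) /=.
rewrite [RHS]big_mkcond /= [LHS]big_seq [RHS]big_seq; apply: eq_bigr => m mp.
rewrite -mul_mpolyC rmorphM /= shiftpC mul_polyC coefZ.
have [sm cm] := topcoef_monomial e m.
case: eqVneq => [<-|md]; last first.
  rewrite nth_default ?mulr0 //; apply: leq_trans sm _.
  have mlt := msize_mdeg_lt mp.
  by rewrite ltn_neqAle md /= -ltnS (ltn_predK mlt).
by rewrite cm -mpolyCM (rmorphM (mev e)) /= mevC /mev mevalX.
Qed.

(** In a direction where the top form does not vanish, [p (x + t e)] keeps its full degree in [t]
    and is monic up to a constant, which makes Euclidean division in [t] possible. *)
Lemma shiftp_lead e p : mev e (top p) != 0 ->
  size (shiftp e p) = mmeasure mdeg p /\
  lead_coef (shiftp e p) = mpolyC n (mev e (top p)).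
Proof.
move=> pe; have := shiftp_top e p; have := shiftp_size e p => sz cf.
have szE : size (shiftp e p) = mmeasure mdeg p.
  apply/eqP; rewrite eqn_leq sz /= leqNgt; apply/negP => lt.
  move: cf; rewrite nth_default; last by rewrite -ltnS (leq_trans lt) ?leqSpred.
  by move/eqP; rewrite eq_sym mpolyC_eq0 (negbTE pe).
by rewrite lead_coefE szE.
Qed.
End TopForm.

(** * Second derivative test and Laplacian *)

Section SecondDerivativeTest.
Variable R : realType.

Lemma is_derive_line (V : normedModType R) (f : V -> R) (x e : V) (t d : R) :
  is_derive (t *: e + x) e f d -> is_derive t 1 (fun s : R => f (s *: e + x)) d.
Proof.
move=> [fd fD].
have E : (fun h : R => h^-1 *: (((fun s => f (s *: e + x)) \o shift t) (h *: 1)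
             - f (t *: e + x))) =
         (fun h : R => h^-1 *: ((f \o shift (t *: e + x)) (h *: e)
             - f (t *: e + x))).
  apply/funext => h; congr (_ *: (_ - _)) => /=.
  by rewrite [h *: 1]mulr1 scalerDl addrA.
by apply: DeriveDef; [move: fd|move: fD]; rewrite /derivable /derive E.
Qed.

(** The maximum forces [phi1 0 = 0]. If [a > 0], then [phi1] is positive just to the right of 0, and
    the mean value theorem gives a point with [phi b > phi 0]. *)
Lemma deriv2_le0_at_max (phi phi1 : R -> R) (a r : R) : 0 < r ->
  (forall t : R, is_derive t 1 phi (phi1 t)) -> is_derive (0 : R) 1 phi1 a ->
  (forall t, `|t| < r -> phi t <= phi 0) -> a <= 0.
Proof.
move=> r0 dphi dphi1 pmax.
have phi10 : phi1 0 = 0.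
  have dphi0 : is_derive (0 : R) 1 phi 0.
    apply: (@derive1_at_max R phi (- r) r 0) => [|t _||t]; first by lra.
    - exact: (@ex_derive _ _ _ _ _ _ _ (dphi t)).
    - by rewrite in_itv /= oppr_lt0 r0.
    - by rewrite in_itv /= => ?; apply: pmax; rewrite ltr_norml.
  by rewrite -(@derive_val _ _ _ _ _ _ _ (dphi 0)) derive_val.
rewrite leNgt; apply/negP => a0.
have := @ex_derive _ _ _ _ _ _ _ dphi1; rewrite /derivable => /cvg_ex [l lP].
have la : l = a.
  by rewrite -(@derive_val _ _ _ _ _ _ _ dphi1) /derive (cvg_lim _ lP).
subst l.
move/cvgrPdist_lt : lP => /(_ a a0) [d /= d0 dP].
pose b := Num.min (d / 2) (r / 2).
have b0 : 0 < b by rewrite /b lt_min; apply/andP; split; lra.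
have bd : b < d by rewrite /b gt_min; apply/orP; left; lra.
have br : b < r by rewrite /b gt_min; apply/orP; right; lra.
have cphi : {within `[0, b], continuous phi}.
  apply: derivable_within_continuous => t _;
    exact: (@ex_derive _ _ _ _ _ _ _ (dphi t)).
have [c /[!in_itv]/= /andP[c0 cb] E] := MVT b0 (fun x _ => dphi x) cphi.
have c1 : 0 < phi1 c.
  have : `|a - c^-1 *: (phi1 (c *: 1 + 0) - phi1 0)| < a.
    apply: dP => /=; last by rewrite gt_eqF.
    by rewrite sub0r normrN gtr0_norm //; exact: lt_trans cb bd.
  rewrite phi10 subr0 addr0 [c *: 1]mulr1 ltr_distlC => /andP[+ _].
  by rewrite subrr pmulr_rgt0 // invr_gt0.
have := pmax b; rewrite gtr0_norm // => /(_ br).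
rewrite leNgt => /negP; apply.
by rewrite -subr_gt0 E mulr_gt0 // subr0.
Qed.
End SecondDerivativeTest.

Section Laplacian.
Variables (R : realType) (n : nat).
Implicit Types (f g F G : 'rV[R]_n -> R) (x y : 'rV[R]_n).

Local Notation dir i := (delta_mx (ord0 : 'I_1) i).

Lemma rV_norm_le x b : 0 <= b -> (forall i, `|x ord0 i| <= b) -> `|x| <= b.
Proof.
move=> b0 xb; have -> : `|x| = mx_norm x by [].
rewrite mx_normrE; apply/bigmax_leP; split=> // -[k j] _ /=.
by rewrite (ord1 k).
Qed.

Lemma coord_le_norm x i : `|x ord0 i| <= `|x|.
Proof.
have -> : `|x| = mx_norm x by [].
by rewrite mx_normrE; apply/bigmax_geP; right => /=; exists (ord0, i).
Qed.

(** The relation carries witnesses for the first and second partial derivatives and asks nothing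
    about their continuity, so sums, multiples and reflections are handled by transforming the
    witnesses. *)
Definition has_laplacian f F := exists f1 f2 : 'I_n -> 'rV[R]_n -> R,
  [/\ forall i x, is_derive x (dir i) f (f1 i x),
      forall i x, is_derive x (dir i) (f1 i) (f2 i x) &
      forall x, F x = \sum_i f2 i x].

Lemma is_harmonic_laplacian f : is_harmonic f ->
  continuous f /\ has_laplacian f (fun=> 0).
Proof.
move=> [[cf df] lf]; split=> //.
exists (fun i => partial i f), (fun i => partial i (partial i f)).
split=> [i x|i x|x]; last by rewrite -[LHS](lf x).
- by apply: derivableP; exact: (df i).1.
- by apply: derivableP; have [_ [_ /(_ i) [dd _]]] := df i; exact: dd.
Qed.

Lemma laplacian_le0_at_max f F x r : has_laplacian f F -> 0 < r ->
  (forall y, `|y - x| < r -> f y <= f x) -> F x <= 0.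
Proof.
move=> [f1 [f2 [df1 df2 ->]]] r0 fmax; apply: sumr_le0 => i _.
apply: (@deriv2_le0_at_max _ (fun t => f (t *: dir i + x))
  (fun t => f1 i (t *: dir i + x)) _ r) => // [t||t tr].
- by apply: is_derive_line; exact: df1.
- apply: is_derive_line; rewrite scale0r add0r; exact: df2.
rewrite scale0r add0r; apply: fmax; rewrite addrK normrZ.
suff : `|dir i : 'rV[R]_n| <= 1.
  by move=> d1; apply: le_lt_trans tr; rewrite ler_piMr.
apply: rV_norm_le => // j.
by rewrite mxE; case: (_ && _); rewrite ?normr1 ?normr0.
Qed.

Lemma has_laplacianD f F g G : has_laplacian f F -> has_laplacian g G ->
  has_laplacian (fun x => f x + g x) (fun x => F x + G x).
Proof.
move=> [f1 [f2 [df1 df2 FE]]] [g1 [g2 [dg1 dg2 GE]]].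
exists (fun i x => f1 i x + g1 i x), (fun i x => f2 i x + g2 i x).
split=> [i x|i x|x]; last by rewrite FE GE big_split.
- exact: (is_deriveD (df1 i x) (dg1 i x)).
- exact: (is_deriveD (df2 i x) (dg2 i x)).
Qed.

Lemma has_laplacianZ c f F : has_laplacian f F ->
  has_laplacian (fun x => c * f x) (fun x => c * F x).
Proof.
move=> [f1 [f2 [df1 df2 FE]]].
exists (fun i x => c * f1 i x), (fun i x => c * f2 i x).
split=> [i x|i x|x]; last by rewrite FE mulr_sumr.
- exact: (is_deriveZ c (df1 i x)).
- exact: (is_deriveZ c (df2 i x)).
Qed.

(** With all signs 1 this covers translations, with one sign -1 reflections in a coordinate
    hyperplane. Each second derivative picks up [s i ^+ 2 = 1]. *)
Lemma has_laplacian_comp f F (s : 'I_n -> R) (c : 'rV[R]_n) :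
  (forall i, s i ^+ 2 = 1) -> has_laplacian f F ->
  has_laplacian (fun x => f (\row_i (s i * x ord0 i) + c))
    (fun x => F (\row_i (s i * x ord0 i) + c)).
Proof.
move=> s2 [f1 [f2 [df1 df2 FE]]].
pose S x : 'rV[R]_n := \row_i (s i * x ord0 i) + c.
have key (h : 'rV[R]_n -> R) d i x : is_derive (S x) (dir i) h d ->
    is_derive x (dir i) (h \o S) (s i * d).
  move=> hd.
  have E : (fun t : R => (h \o S) (t *: dir i + x)) =
           (fun t : R => h ((s i * t) *: dir i + S x)).
    apply/funext => t /=; congr (h _); apply/rowP => j; rewrite !mxE eqxx /=.
    by case: eqVneq => [->|_] /=; ring.
  have hS : is_derive (0 : R) 1 (fun t : R =>
    (h \o S) (t *: dir i + x)) (s i * d).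
    rewrite E.
    have l1 : is_derive (0 : R) 1 ( *%R (s i)) (s i).
      by apply: is_derive_eq (is_deriveZ (s i) (is_derive_id (0 : R) 1)) _;
        exact: mulr1.
    have h0 : is_derive (s i * 0) 1 (fun t : R => h (t *: dir i + S x)) d.
      by apply: is_derive_line; rewrite mulr0 scale0r add0r.
    by have := is_derive1_comp h0 l1; rewrite /comp mulrC.
  case: hS => hdd hdE; apply: DeriveDef; first exact/derivable1P.
  rewrite -hdE /derive; set g1 := fun t => t^-1 *: _;
    set g2 := fun t => t^-1 *: _.
  suff -> : g1 = g2 by [].
  by apply/funext => t; rewrite /g1 /g2 /= addr0 scale0r add0r [t%:A]mulr1.
exists (fun i x => s i * f1 i (S x)), (fun i x => f2 i (S x)).
split=> [i x|i x|x]; last by rewrite FE.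
- by apply: key; exact: df1.
- have := is_deriveZ (s i) (key _ _ _ _ (df2 i (S x))).
  by rewrite scalerA -expr2 s2 scale1r.
Qed.
End Laplacian.

(** * The formal Laplacian of polynomials *)

Section MLaplacian.
Variables (R : realType) (n : nat).
Implicit Types (p q : mpoly n R).

Definition mlap p : mpoly n R := \sum_i mderiv i (mderiv i p).

Lemma has_laplacian_mev p :
  has_laplacian (fun y => mev y p) (fun y => mev y (mlap p)).
Proof.
exists (fun i y => mev y (mderiv i p)),
  (fun i y => mev y (mderiv i (mderiv i p))).
split=> [i x|i x|x]; [exact: is_derive_mev|exact: is_derive_mev|].
by rewrite /mlap (rmorph_sum (mev x)).
Qed.

Lemma mlapD p q : mlap (p + q) = mlap p + mlap q.
Proof. by rewrite /mlap -big_split; apply: eq_bigr => i _;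
  rewrite !mderivD. Qed.

Lemma mlapZ c p : mlap (c *: p) = c *: mlap p.
Proof. by rewrite /mlap scaler_sumr; apply: eq_bigr => i _;
  rewrite !mderivZ. Qed.

Lemma mlap0 : mlap 0 = 0.
Proof. by rewrite -(scale0r (0 : mpoly n R)) mlapZ !scale0r. Qed.

Lemma mlap_sum (I : Type) (r : seq I) (P : pred I) (F : I -> mpoly n R) :
  mlap (\sum_(i <- r | P i) F i) = \sum_(i <- r | P i) mlap (F i).
Proof. by rewrite (big_morph mlap mlapD mlap0). Qed.

Lemma mlapX i : mlap (var i) = 0.
Proof.
rewrite /mlap big1 // => j _; rewrite mderivXU -mpolyC_nat; exact: mderivC.
Qed.

Lemma mlapX2 i : mlap (var i ^+ 2) = 2.
Proof.
rewrite /mlap (bigD1 i) //= big1 => [|j /negbTE ji].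
  rewrite expr2 mderivM mderivXU eqxx mul1r mulr1 mderivD mderivXU eqxx addr0.
  by rewrite -mulr2n.
by rewrite expr2 mderivM mderivXU eq_sym ji mul0r mulr0 addr0 mderiv0.
Qed.
End MLaplacian.

(** * Reflection estimate *)

Section ReflectionEstimate.
Variables (R : realType) (n : nat).
Implicit Types (f : 'rV[R]_n -> R) (x y : 'rV[R]_n).

Local Notation dir i := (delta_mx (ord0 : 'I_1) i).

Lemma rV_norm_lt x b : 0 < b -> (forall i, `|x ord0 i| < b) -> `|x| < b.
Proof.
move=> b0 xb; have -> : `|x| = mx_norm x by [].
rewrite mx_normrE; apply/bigmax_ltP; split=> // -[k j] _ /=.
by rewrite (ord1 k).
Qed.

(** With [T = y_i / r] this is [(n + 1) T - n T^2] plus the squares of the other [y_j / r]. It is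
    strictly superharmonic, nonnegative for [0 <= T <= 1], at least 1 on the faces of the half cube
    off the mirror [y_i = 0], and at most [(n + 1) s / r] at height [s] on the axis. *)
Definition barrier (i : 'I_n) (r : R) : mpoly n R :=
  \sum_j (if j == i then - n%:R / r ^+ 2 else r ^- 2) *: var j ^+ 2
  + ((n%:R + 1) / r) *: var i.

Lemma mev_barrier i r y : 0 < r -> mev y (barrier i r) =
  (n%:R + 1) * (y ord0 i / r) - n%:R * (y ord0 i / r) ^+ 2
  + \sum_(j | j != i) (y ord0 j / r) ^+ 2.
Proof.
move=> r0; have rn0 : r != 0 by rewrite gt_eqF.
rewrite /barrier rmorphD (rmorph_sum (mev y)) /= (bigD1 i) //= eqxx.
rewrite -!mul_mpolyC !rmorphM /= !mevC !mevX.
rewrite [\sum_(_ | _) mev _ _](_ : _ = \sum_(j | j != i) (y ord0 j / r) ^+ 2).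
  by field.
apply: eq_bigr => j /negbTE ->.
by rewrite -mul_mpolyC !rmorphM /= mevC mevX; field.
Qed.

Lemma mlap_barrier i r : mlap (barrier i r) = mpolyC n (- 2 / r ^+ 2).
Proof.
have cards : (\sum_(j < n | j != i) 1 = n%:R - 1 :> R).
  have := sumr_const 'I_n (1 : R).
  rewrite (bigD1 i) //= card_ord => /(canRL (addKr _)) ->; ring.
rewrite /barrier mlapD mlapZ mlapX scaler0 addr0 mlap_sum (bigD1 i) //= eqxx.
rewrite mlapZ mlapX2 (eq_bigr (fun=> mpolyC n (r ^- 2 * 2))); last first.
  move=> j /negbTE ->; rewrite mlapZ mlapX2 -mul_mpolyC -[2]mpolyC_nat.
  by rewrite -mpolyCM.
rewrite -(raddf_sum (@mpolyC n R)) /= -mul_mpolyC -[2 as X in _ * X]mpolyC_nat.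
rewrite -mpolyCM -mpolyCD -[r ^- 2 * 2]mul1r -mulr_suml cards.
by congr (mpolyC n _); rewrite -exprVn; ring.
Qed.

(** The function [Phi] is [f] minus its reflection minus [2 M] times the barrier. It is at most 0 on
    the boundary of the half cube and strictly subharmonic, hence at most 0 inside; its value at [s]
    on the axis gives the bound. *)
Lemma reflection_estimate_le f x i (r M s : R) :
  continuous f -> has_laplacian f (fun=> 0) -> 0 < r -> 0 < M ->
  (forall y, `|y - x| <= r -> `|f y| <= M) -> 0 <= s <= r ->
  f (x + s *: dir i) - f (x - s *: dir i) <= 2 * M * (n%:R + 1) * (s / r).
Proof.
move=> cf lf r0 M0 fM /andP[s0 sr].
pose sg (j : 'I_n) : R := if j == i then -1 else 1.
pose S1 y : 'rV[R]_n := \row_j (1 * y ord0 j) + x.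
pose S2 y : 'rV[R]_n := \row_j (sg j * y ord0 j) + x.
pose Phi y := f (S1 y) + (-1) * f (S2 y) + (- (2 * M)) * mev y (barrier i r).
have lPhi : has_laplacian Phi
    (fun y => 0 + (-1) * 0 + (- (2 * M)) * mev y (mlap (barrier i r))).
  apply: has_laplacianD; last exact/has_laplacianZ/has_laplacian_mev.
  apply: has_laplacianD; last apply: has_laplacianZ.
    by apply: (has_laplacian_comp (F := fun=> 0)) lf => j; rewrite expr1n.
  apply: (has_laplacian_comp (F := fun=> 0)) lf => j; rewrite /sg.
  by case: ifP; rewrite ?sqrrN expr1n.
have cS1 : continuous S1.
  have -> : S1 = (fun y => y + x).
    by apply/funext => y; congr (_ + _); apply/rowP => j; rewrite mxE mul1r.
  by move=> y; apply: continuousD; [exact: cvg_id|exact: cst_continuous].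
have cS2 : continuous S2.
  have -> : S2 = (fun y => (y - (2 * y ord0 i) *: dir i) + x).
    apply/funext => y; congr (_ + _); apply/rowP => j; rewrite !mxE eqxx /sg /=.
    by case: eqVneq => [->|_]; rewrite /=; ring.
  have c2 : continuous (fun y : 'rV[R]_n => 2 * y ord0 i).
    move=> y; apply: (@continuousM _ _ (cst 2)); first exact: cst_continuous.
    exact: coord_continuous.
  have c3 : continuous (fun y : 'rV[R]_n => (2 * y ord0 i) *: dir i : 'rV[R]_n).
    move=> y; apply: (@continuousZr_tmp R ('rV[R]_n) ('rV[R]_n)
      (fun y => 2 * y ord0 i) _ y (c2 y)).
  move=> y; apply: (@continuousD _ _ _ (fun y =>
    y - (2 * y ord0 i) *: dir i) (cst x)).
    by apply: (@continuousB _ _ _ id); [exact: cvg_id|exact: c3].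
  exact: cst_continuous.
have cPhi : continuous Phi.
  move=> y; apply: (@continuousD _ _ _ (fun y => f (S1 y) + -1 * f (S2 y))
    (fun y => - (2 * M) * mev y (barrier i r))).
    apply: (@continuousD _ _ _ (f \o S1) (fun y => -1 * f (S2 y))).
      by apply: continuous_comp; [exact: cS1|exact: cf].
    apply: (@continuousM _ _ (cst (-1)) (f \o S2)); first exact: cst_continuous.
    by apply: continuous_comp; [exact: cS2|exact: cf].
  apply: (@continuousM _ _ (cst (- (2 * M)))); first exact: cst_continuous.
  exact: continuous_mev.
pose K := [set y : 'rV[R]_n | `|y| <= r] `&` [set y | 0 <= y ord0 i].
have Kse : K (s *: dir i).
  split; rewrite /= ?mxE ?eqxx ?mulr1 //.
  apply: rV_norm_le => [|j]; first exact: ltW.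
  rewrite !mxE eqxx /=; case: (_ == _).
    by rewrite mulr1 ger0_norm.
  by rewrite mulr0 normr0 ltW.
have cK : compact K.
  apply: bounded_closed_compact.
    by exists r; split; [exact: num_real|move=> b rb y [/= yr _];
      apply: le_trans (ltW rb)].
  apply: closedI.
    apply: (@preimage_closed _ _ (fun y : 'rV[R]_n => `|y|) [set t | t <= r]).
      by move=> y _; exact: norm_continuous.
    exact: closed_le.
  apply: (@preimage_closed _ _ (fun y : 'rV[R]_n => y ord0 i) [set t | 0 <= t]).
    by move=> y _; exact: coord_continuous.
  exact: closed_ge.
have [c /[!inE] -[cr ci] cmax] :
  exists2 c, c \in K & forall t, t \in K -> Phi t <= Phi c.
  by apply: EVT_max_rV => //; [exists (s *: dir i)|exact: continuous_subspaceT].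
rewrite /= in cr ci.
have PhiK y : K y -> Phi y <= Phi c by move=> Ky; apply: cmax; rewrite inE.
have n0 : 0 <= n%:R :> R by [].
have tau : 0 <= c ord0 i / r <= 1.
  rewrite divr_ge0 ?(ltW r0) //= ler_pdivrMr // mul1r.
  exact: le_trans (ler_norm _) (le_trans (coord_le_norm _ _) cr).
have fS y : K y -> `|f (S1 y)| <= M /\ `|f (S2 y)| <= M.
  move=> [/= yr _]; split; apply: fM; rewrite addrK; apply: le_trans yr.
    by apply: rV_norm_le => // j; rewrite mxE mul1r coord_le_norm.
  apply: rV_norm_le => // j; rewrite mxE normrM /sg.
  by case: ifP; rewrite ?normrN normr1 mul1r coord_le_norm.
have Phi_c : Phi c <= 0.
  have [/(le_trans (ler_norm _)) f1] := fS c (conj cr ci).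
  rewrite ler_norml => /andP[f2 _].
  (* On the outer faces the two values of [f] differ by at most [2 * M], which the barrier
     absorbs. *)
  have bdry : 1 <= mev c (barrier i r) -> Phi c <= 0.
    move=> b1; rewrite /Phi.
    have : 2 * M <= 2 * M * mev c (barrier i r) by rewrite ler_peMr // mulr_ge0
      // (ltW M0).
    lra.
  have sq0 : 0 <= \sum_(j | j != i) (c ord0 j / r) ^+ 2.
    by apply: sumr_ge0 => j _; exact: sqr_ge0.
  have parab : c ord0 i / r <= (n%:R + 1) * (c ord0 i / r) - n%:R * (c ord0 i /
    r) ^+ 2.
    case/andP: tau => t0 t1.
    have : 0 <= n%:R * ((c ord0 i / r) * (1 - c ord0 i / r)).
      by rewrite mulr_ge0 // mulr_ge0 // subr_ge0.
    by rewrite expr2; lra.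
  (* On the mirror the two values of [f] cancel and only the barrier remains. *)
  have [ci0|ci0] := eqVneq (c ord0 i) 0.
    have -> : Phi c = - (2 * M) * mev c (barrier i r).
      rewrite /Phi; have -> : S2 c = S1 c; last by ring.
      congr (_ + _); apply/rowP => j; rewrite !mxE /sg.
      by case: eqVneq => [->|//]; rewrite ci0 !mulr0.
    rewrite mulNr oppr_le0 mulr_ge0 ?mulr_ge0 ?(ltW M0) //.
    by rewrite mev_barrier // ci0 mul0r expr0n /= !mulr0 subr0 add0r.
  have {ci0}ci0 : 0 < c ord0 i by rewrite lt_neqAle eq_sym ci0.
  have [/forallP clt|/forallPn [k]] := boolP [forall j, `|c ord0 j| < r];
    last first.
    rewrite -leNgt => rk; apply: bdry; rewrite mev_barrier //.
    have ck : 1 <= (c ord0 k / r) ^+ 2.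
      rewrite -real_normK ?num_real // normrM normfV (gtr0_norm r0).
      by rewrite exprn_ege1 // ler_pdivlMr // mul1r.
    have [ki|ki] := eqVneq k i.
      have : 1 <= c ord0 i / r.
        by rewrite ler_pdivlMr // mul1r -(gtr0_norm ci0) -ki.
      lra.
    rewrite [X in _ <= _ + X](bigD1 k) //=.
    have : 0 <= \sum_(j | (j != i) && (j != k)) (c ord0 j / r) ^+ 2.
      by apply: sumr_ge0 => j _; exact: sqr_ge0.
    lra.
  have cltr : `|c| < r by exact: rV_norm_lt.
  (* The ball of radius [d] about [c] stays in the half cube, so an interior [c] is a local maximum;
     but the Laplacian of [Phi] is the positive constant [4 M / r^2]. *)
  pose d := Num.min (c ord0 i) (r - `|c|).
  have d0 : 0 < d by rewrite lt_min ci0 subr_gt0.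
  have := laplacian_le0_at_max lPhi d0 (x := c).
  rewrite mlap_barrier mevC => H; exfalso.
  have : 0 + -1 * 0 + - (2 * M) * (- 2 / r ^+ 2) <= 0.
    apply: H => y yc; apply: PhiK; split=> /=.
      have := ler_normD (y - c) c; rewrite subrK.
      have : `|y - c| < r - `|c| by apply: lt_le_trans yc _;
        rewrite ge_min lexx orbT.
      by lra.
    have := coord_le_norm (y - c) i; rewrite !mxE ler_norml => /andP[+ _].
    have : `|y - c| < c ord0 i by apply: lt_le_trans yc _; rewrite ge_min lexx.
    by lra.
  have : 0 < 2 * M * (2 / r ^+ 2) by rewrite !mulr_gt0 // invr_gt0 exprn_gt0.
  by rewrite !mulNr mulr0; lra.
have := PhiK _ Kse; move=> /le_trans /(_ Phi_c).
have S1E : S1 (s *: dir i) = x + s *: dir i.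
  by rewrite addrC; congr (_ + _); apply/rowP => j; rewrite mxE mul1r.
have S2E : S2 (s *: dir i) = x - s *: dir i.
  rewrite addrC; congr (_ + _); apply/rowP => j; rewrite !mxE eqxx /sg /=.
  by case: eqVneq => _; rewrite /=; ring.
rewrite /Phi S1E S2E mev_barrier // !mxE !eqxx /= mulr1.
rewrite [\sum_(_ | _) _]big1 ?addr0 => [|j /negbTE ji]; last first.
  by rewrite !mxE ji andbF mulr0 mul0r expr0n.
(* The negative quadratic term of the barrier only improves the bound and is dropped. *)
have : 0 <= 2 * M * (n%:R * (s / r) ^+ 2).
  apply: mulr_ge0; first by apply: mulr_ge0 => //; exact: ltW.
  by apply: mulr_ge0 => //; exact: sqr_ge0.
by lra.
Qed.

Lemma reflection_estimate f x i (r M s : R) :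
  continuous f -> has_laplacian f (fun=> 0) -> 0 < r -> 0 < M ->
  (forall y, `|y - x| <= r -> `|f y| <= M) -> 0 <= s <= r ->
  `|f (x + s *: dir i) - f (x - s *: dir i)| <= 2 * M * (n%:R + 1) * (s / r).
Proof.
move=> cf lf r0 M0 fM sr; rewrite ler_norml reflection_estimate_le // andbT.
have cf' : continuous (fun y => -1 * f y).
  by move=> y; apply: (@continuousM _ _ (cst (-1)) f);
    [exact: cst_continuous|exact: cf].
have lf' : has_laplacian (fun y => -1 * f y) (fun=> 0).
  by have := has_laplacianZ (-1) lf; rewrite mulr0.
have fM' y : `|y - x| <= r -> `|-1 * f y| <= M by rewrite mulN1r normrN;
  exact: fM.
by have := reflection_estimate_le i cf' lf' r0 M0 fM' sr; lra.
Qed.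
End ReflectionEstimate.

(** * Liouville's theorem *)

Section Frechet.
Variable R : realType.
Implicit Types (phi : R -> R) (p : {poly R}).

(** Newton's form: each new node adds a multiple of the product [w] that vanishes at the earlier
    nodes. *)
Lemma interpolation (N : nat) (x v : nat -> R) : injective x ->
  exists2 p : {poly R}, (size p <= N.+1)%N &
    forall j, (j <= N)%N -> p.[x j] = v j.
Proof.
move=> xI; elim: N => [|N [p sp pv]].
  exists (v 0)%:P; first exact: size_polyC_leq1.
  by move=> j; rewrite leqn0 => /eqP ->; rewrite hornerC.
pose w := \prod_(j <- map x (iota 0 N.+1)) ('X - j%:P).
have wN : w.[x N.+1] != 0.
  rewrite -rootE root_prod_XsubC; apply/mapP => -[j].
  by rewrite mem_iota add0n => jN /xI jE; rewrite -jE ltnn in jN.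
exists (p + ((v N.+1 - p.[x N.+1]) / w.[x N.+1]) *: w).
  apply: leq_trans (size_polyD _ _) _; rewrite geq_max (leq_trans sp) //=.
  apply: leq_trans (size_scale_leq _ _) _.
  by rewrite size_prod_XsubC size_map size_iota.
move=> j; rewrite hornerD hornerZ leq_eqVlt => /predU1P[->|jN].
  by rewrite divfK // addrC subrK.
have -> : w.[x j] = 0.
  apply/rootP; rewrite root_prod_XsubC; apply: map_f.
  by rewrite mem_iota add0n.
by rewrite mulr0 addr0 pv.
Qed.

Definition dif (s : R) phi : R -> R := fun t => phi (t + s) - phi t.

Lemma iter_difB m s f g t :
  iter m (dif s) (fun t =>
    f t - g t) t = iter m (dif s) f t - iter m (dif s) g t.
Proof. by elim: m t => //= m IHm t; rewrite /dif !IHm; ring. Qed.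

(** A translate has the same degree and leading coefficient, so each difference lowers the size by
    at least one. *)
Lemma iter_dif_poly m s p : (size p <= m)%N ->
  forall t, iter m (dif s) (horner p) t = 0.
Proof.
elim: m p => [|m IHm] p.
  by rewrite leqn0 size_poly_eq0 => /eqP -> t; rewrite /= horner0.
move=> sp t; rewrite iterSr.
pose q := p \Po ('X + s%:P) - p.
have -> : dif s (horner p) = horner q.
  by apply/funext => y; rewrite /dif /q !hornerE horner_comp !hornerE.
apply: IHm; rewrite {}/q;
  have sX : size ('X + s%:P) = 2%N by rewrite size_XaddC.
have [->|p0] := eqVneq p 0; first by rewrite comp_poly0 subrr size_poly0.
have sc := size_comp_poly2 p sX.
apply/leq_sizeP => j mj; rewrite coefB.
have [jp|jp] := leqP (size p) j; first by rewrite !nth_default ?sc ?subrr.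
have jE : j = (size p).-1 by move: jp sp mj; lia.
have := @lead_coef_comp _ p ('X + s%:P); rewrite sX => /(_ isT).
rewrite (_ : lead_coef ('X + s%:P) = 1); last exact/eqP/monicXaddC.
by rewrite expr1n mulr1 !lead_coefE sc -jE => ->; rewrite subrr.
Qed.

(** Along an arithmetic progression the vanishing of the difference of order [N.+1] is a linear
    recurrence, determined by [N.+1] initial values. *)
Lemma iter_dif_seq_eq0 N (s a : R) phi :
  (forall t, iter N.+1 (dif s) phi t = 0) ->
  (forall j, (j <= N)%N -> phi (a + j%:R * s) = 0) ->
  forall j : nat, phi (a + j%:R * s) = 0.
Proof.
elim: N phi => [|N IHN] phi dphi phi0.
  elim=> [|j IHj]; first exact: phi0.
  have /eqP := dphi (a + j%:R * s); rewrite /= /dif subr_eq0 IHj => /eqP E.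
  by rewrite -[RHS]E; congr phi; rewrite -natr1; ring.
have step (j : nat) :
  dif s phi (a + j%:R * s) = phi (a + j.+1%:R * s) - phi (a + j%:R * s).
  by rewrite /dif; congr (phi _ - _); rewrite -natr1; ring.
have d0 : forall j : nat, dif s phi (a + j%:R * s) = 0.
  apply: IHN => [t|j jN]; first by rewrite -iterSr.
  by rewrite step !phi0 ?subrr // ltnW.
elim=> [|j IHj]; first exact: phi0.
by have /eqP := d0 j; rewrite step IHj subr0 => /eqP.
Qed.

(** On the grid of step [1 / q.+1] starting at [- m], the recurrence makes [phi] agree with a
    polynomial of size at most [N.+1]. The grid contains [0, ..., N], so that polynomial is 0. The
    grids cover the rationals, and continuity does the rest. *)
Lemma frechet_eq0 N phi : continuous phi ->
  (forall s t, 0 <= s -> iter N.+1 (dif s) phi t = 0) ->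
  (forall j, (j <= N)%N -> phi j%:R = 0) -> forall t, phi t = 0.
Proof.
move=> cphi dphi phi0.
have grid (m q j : nat) : phi (- m%:R + j%:R * q.+1%:R^-1) = 0.
  pose x (j : nat) : R := - m%:R + j%:R * q.+1%:R^-1.
  have q0 : q.+1%:R^-1 != 0 :> R by rewrite invr_eq0 pnatr_eq0.
  have xI : injective x.
    by move=> i k /addrI /(mulIf q0) /eqP; rewrite eqr_nat => /eqP.
  have [p sp pv] := interpolation N (fun j => phi (x j)) xI.
  have ext (k : nat) : phi (x k) - p.[x k] = 0.
    apply: (@iter_dif_seq_eq0 N q.+1%:R^-1 (- m%:R) (fun t => phi t - p.[t])).
      by move=> t; rewrite iter_difB dphi ?invr_ge0 // iter_dif_poly // subrr.
    by move=> i iN; rewrite -/(x i) pv // subrr.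
  suff p0 : p = 0 by have := ext j; rewrite p0 horner0 subr0.
  apply: (@roots_geq_poly_eq0 _ _ [seq i%:R | i <- iota 0 N.+1]).
  - rewrite all_map; apply/allP => i; rewrite mem_iota add0n /= => iN.
    have xE : x (q.+1 * (m + i))%N = i%:R.
      rewrite /x natrM natrD; move: q0; set Q : R := q.+1%:R.
      by rewrite invr_eq0 => Q0; field.
    by have := ext (q.+1 * (m + i))%N; rewrite xE phi0 // sub0r rootE => /eqP;
      rewrite oppr_eq0.
  - by rewrite map_inj_uniq ?iota_uniq // => i k /eqP; rewrite eqr_nat => /eqP.
  - by rewrite size_map size_iota.
move=> t; apply/eqP/negPn/negP => t0.
have Oo : open (phi @^-1` [set y | y != 0]).
  by apply: open_comp => [y _|]; [exact: cphi|exact: open_neq].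
have [y [/= + [r _ ry]]] := dense_rat (ex_intro _ t t0) Oo.
rewrite -ry {y ry}; move/eqP; apply.
(* With [m = |numq r|] and [q.+1 = denq r], the rational [r] is the grid point of this index, which
   is nonnegative because [denq r >= 1]. *)
have [j jE] : exists j : nat, numq r + (absz (numq r))%:Z * denq r = j%:Z.
  exists (absz (numq r + (absz (numq r))%:Z * denq r)%R).
  rewrite [RHS]gez0_abs //.
  have d1 : 1 <= denq r := denq_gt0 r.
  have : (absz (numq r))%:Z <= (absz (numq r))%:Z * denq r by rewrite ler_peMr.
  rewrite addrC -lerBlDr sub0r; apply: le_trans.
  by rewrite abszE -normrN ler_norm.
have dE : denq r = ((absz (denq r)).-1.+1)%:Z.
  by rewrite prednK ?absz_gt0 ?denq_neq0 // gez0_abs // ltW // denq_gt0.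
have d0 : (denq r)%:~R != 0 :> R by rewrite intr_eq0 denq_neq0.
have := grid (absz (numq r)) (absz (denq r)).-1 j.
suff -> : - (absz (numq r))%:R + j%:R * ((absz (denq r)).-1.+1)%:R^-1 = ratr r
  :> R by [].
have -> : ((absz (denq r)).-1.+1)%:R = (denq r)%:~R :> R by rewrite [in RHS]dE.
have -> : j%:R = (numq r + (absz (numq r))%:Z * denq r)%:~R :> R by rewrite jE.
by rewrite /ratr intrD intrM; field.
Qed.
End Frechet.

(** * Differences of harmonic functions of polynomial growth *)

Section Liouville.
Variables (R : realType) (n : nat).
Implicit Types (f : 'rV[R]_n -> R) (x y z : 'rV[R]_n).

Local Notation dir i := (delta_mx (ord0 : 'I_1) i).

Definition harm f := continuous f /\ has_laplacian f (fun=> 0).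

Definition fdiff (i : 'I_n) (s : R) f := fun x => f (x + s *: dir i) - f x.

Lemma fdiff_harm i s f : harm f -> harm (fdiff i s f).
Proof.
move=> [cf lf].
have ct : continuous (fun x => f (x + s *: dir i)).
  move=> x; apply: (@continuous_comp _ _ _ (fun x => x + s *: dir i) f).
    by apply: (@continuousD _ _ _ id (cst _));
      [exact: cvg_id|exact: cst_continuous].
  exact: cf.
split; first by move=> x; apply: continuousB; [exact: ct|exact: cf].
have -> : fdiff i s f = fun x =>
  f (\row_j (1 * x ord0 j) + s *: dir i) + -1 * f x.
  apply/funext => x; rewrite /fdiff mulN1r; congr (f (_ + _) - _).
  by apply/rowP => j; rewrite mxE mul1r.
have -> : (fun=> 0) = (fun x : 'rV[R]_n => 0 + -1 * 0 : R).
  by apply/funext => x; rewrite mulr0 addr0.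
apply: has_laplacianD; last exact: has_laplacianZ.
by apply: (has_laplacian_comp (F := fun=> 0)) lf => j; rewrite expr1n.
Qed.

Lemma dir_norm_le1 (i : 'I_n) : `|dir i : 'rV[R]_n| <= 1.
Proof.
by apply: rV_norm_le => // j; rewrite mxE; case: (_ && _);
  rewrite ?normr1 ?normr0.
Qed.

(** The two points are mirror images about their midpoint [x + (s / 2) e_i], at distance [s / 2]
    from it. *)
Lemma fdiff_estimate f x i (r M s : R) :
  harm f -> 0 < M -> 0 <= s <= r -> 0 < r ->
  (forall y, `|y| <= `|x| + s + r -> `|f y| <= M) ->
  `|fdiff i s f x| <= M * (n%:R + 1) * (s / r).
Proof.
move=> [cf lf] M0 /andP[s0 sr] r0 fM.
have sr2 : 0 <= s / 2 <= r by apply/andP; split; lra.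
have fM' y : `|y - (x + (s / 2) *: dir i)| <= r -> `|f y| <= M.
  move=> yr; apply: fM.
  have := ler_normD (y - (x + (s / 2) *: dir i)) (x + (s / 2) *: dir i).
  rewrite subrK => /le_trans; apply.
  have : `|(s / 2) *: dir i : 'rV[R]_n| <= s / 2.
    rewrite normrZ ger0_norm; last by lra.
    by rewrite ler_piMr ?dir_norm_le1 //; lra.
  by have := ler_normD x ((s / 2) *: dir i); lra.
have := reflection_estimate i cf lf r0 M0 fM' sr2.
rewrite addrK -addrA -scalerDl -splitr.
by move=> /le_trans; apply; rewrite le_eqVlt; apply/orP; left; apply/eqP;
  field; rewrite gt_eqF.
Qed.

(** A radius comparable to [1 + |x|] costs a constant factor in the bound on [f], while the factor
    [s / r] gains one power of [1 + |x|]. *)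
Lemma fdiff_growth f i s k (C : R) : harm f -> 0 <= s -> 0 < C ->
  (forall x, `|f x| <= C * (1 + `|x|) ^+ k.+1) ->
  exists2 C', 0 < C' & forall x, `|fdiff i s f x| <= C' * (1 + `|x|) ^+ k.
Proof.
move=> hf s0 C0 fC.
have n0 : 0 <= n%:R :> R by [].
exists (C * (2 * (1 + s)) ^+ k.+1 * (n%:R + 1) * (s + 1)).
  by rewrite !mulr_gt0 ?exprn_gt0 //; lra.
move=> x; have x0 : 0 <= `|x| by [].
(* If [|y| <= |x| + s + r], then [1 + |y| <= 2 (1 + |x| + s) <= B]. *)
pose r := 1 + `|x| + s; pose B := 2 * (1 + s) * (1 + `|x|).
have r0 : 0 < r by rewrite /r; lra.
have B0 : 0 < B by rewrite /B !mulr_gt0 //; lra.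
have M0 : 0 < C * B ^+ k.+1 by rewrite mulr_gt0 // exprn_gt0.
have sr : 0 <= s <= r by rewrite s0 /= /r; lra.
apply: (le_trans (fdiff_estimate i hf M0 sr r0 _)) => [y yr|].
  have yB : 1 + `|y| <= B.
    have : 0 <= s * `|x| by rewrite mulr_ge0.
    by move: yr; rewrite /r /B; lra.
  apply: (le_trans (fC y)); rewrite ler_pM2l // lerXn2r // nnegrE ?addr_ge0 //.
  exact: ltW.
have rs : s / r <= (s + 1) / (1 + `|x|).
  have u0 : 0 < 1 + `|x| by lra.
  apply: ler_pM => //; first by rewrite invr_ge0 ltW.
    by lra.
  by rewrite lef_pV2 ?posrE // /r; lra.
apply: (@le_trans _ _ (C * B ^+ k.+1 * (n%:R + 1) * ((s + 1) / (1 + `|x|)))).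
  by rewrite ler_wpM2l // mulr_ge0 ?ltW //; lra.
rewrite le_eqVlt; apply/orP; left; apply/eqP.
rewrite /B [(_ * (1 + `|x|)) ^+ _]exprMn [(1 + `|x|) ^+ k.+1]exprS.
by field; rewrite gt_eqF //; lra.
Qed.

Lemma fdiff_bounded f i s (C : R) : harm f -> 0 <= s -> 0 < C ->
  (forall x, `|f x| <= C) -> forall x, fdiff i s f x = 0.
Proof.
move=> hf s0 C0 fC x; apply/eqP; rewrite -normr_eq0; apply/eqP/le_anti.
rewrite normr_ge0 andbT leNgt; apply/negP => a0.
pose a := `|fdiff i s f x|; pose K := C * (n%:R + 1).
have K0 : 0 < K by rewrite mulr_gt0 // ltr_wpDl.
have q0 : 0 <= K * s / a by rewrite divr_ge0 ?mulr_ge0 // ltW.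
(* Any bound on [f] holds at every scale, so the radius is free; this one makes [K * (s / r)]
   smaller than [a]. *)
pose r := s + K * s / a + 1.
have r0 : 0 < r by rewrite /r; lra.
have sr : 0 <= s <= r by rewrite s0 /= /r; lra.
have := fdiff_estimate i hf C0 sr r0 (fun y _ => fC y) (x := x).
rewrite -/a -/K mulrA ler_pdivlMr // leNgt => /negP; apply.
have aq : a * (K * s / a) = K * s by rewrite mulrCA divff ?mulr1 // gt_eqF.
rewrite /r !mulrDr aq mulr1.
have a1 : 0 < a := a0.
have : 0 <= a * s by rewrite mulr_ge0 // ltW.
by lra.
Qed.

Lemma iter_fdiff_eq0 f i s k (C : R) : harm f -> 0 <= s -> 0 < C ->
  (forall x, `|f x| <= C * (1 + `|x|) ^+ k) ->
  forall x, iter k.+1 (fdiff i s) f x = 0.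
Proof.
move=> hf s0; elim: k f hf C => [|k IHk] f hf C C0 fC.
  by apply: (fdiff_bounded _ hf s0 C0) => x; have := fC x; rewrite expr0 mulr1.
have [C' C'0 dC'] := fdiff_growth i hf s0 C0 fC.
by move=> x; rewrite iterSr; apply: (IHk _ (fdiff_harm i s hf) _ C'0).
Qed.

Lemma iter_fdiff_line f i s k x t :
  iter k (fdiff i s) f (x + t *: dir i) =
  iter k (dif s) (fun t => f (x + t *: dir i)) t.
Proof.
elim: k t => //= k IHk t; rewrite /fdiff /dif -!IHk.
by rewrite scalerDl addrA.
Qed.

(** The [l k] are the Lagrange basis for the nodes [0, ..., N]. They are chosen before [phi], so
    that the same polynomials serve all parallel lines. *)
Lemma frechet_lagrange N : exists l : nat -> {poly R},
  forall phi : R -> R, continuous phi ->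
  (forall s t, 0 <= s -> iter N.+1 (dif s) phi t = 0) ->
  forall t, phi t = \sum_(k < N.+1) phi k%:R * (l k).[t].
Proof.
have natI : injective (fun j : nat => j%:R : R).
  by move=> i j /eqP; rewrite eqr_nat => /eqP.
have lex k : exists p : {poly R}, (size p <= N.+1)%N /\
    forall j, (j <= N)%N -> p.[j%:R] = (j == k)%:R.
  have [p sp pv] := interpolation N (fun j => (j == k)%:R) natI.
  by exists p.
have [l lP] := choice lex.
exists l => phi cphi dphi.
pose P := \sum_(k < N.+1) phi k%:R *: l k.
have PE t : P.[t] = \sum_(k < N.+1) phi k%:R * (l k).[t].
  by rewrite horner_sum; apply: eq_bigr => k _; rewrite hornerZ.
have sP : (size P <= N.+1)%N.
  apply: leq_trans (size_sum _ _ _) _; apply/bigmax_leqP => k _.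
  exact: leq_trans (size_scale_leq _ _) (lP k).1.
move=> t; rewrite -PE; apply/eqP; rewrite -subr_eq0; apply/eqP.
apply: (@frechet_eq0 _ N (fun t => phi t - P.[t])) => [x|s x s0|j jN].
- by apply: continuousB; [exact: cphi|exact: continuous_horner].
- by rewrite iter_difB dphi // iter_dif_poly // subrr.
have jlt : (j < N.+1)%N by [].
rewrite PE (bigD1 (Ordinal jlt)) //= (lP j).2 // eqxx mulr1 big1 ?addr0 ?subrr
  //.
by move=> k /negbTE kj;
  rewrite (lP k).2 // eq_sym -(inj_eq val_inj) /= in kj *; rewrite kj mulr0.
Qed.

Definition mix (j : nat) z x : 'rV[R]_n :=
  \row_i (if (i < j)%N then z ord0 i else x ord0 i).

(** Coordinates are interpolated one after another. After [j] rounds, [f] is a finite sum of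
    polynomials times values of [f] at points whose first [j] coordinates are fixed nodes; after [n]
    rounds these values are constants. *)
Lemma separately_poly (N : nat) (l : nat -> {poly R}) f :
  (forall i x, f x = \sum_(k < N.+1)
     f (x + (k%:R - x ord0 i) *: dir i) * (l k).[x ord0 i]) ->
  exists p, forall x, f x = mev x p.
Proof.
move=> fE.
pose L i k : mpoly n R := (map_poly (@mpolyC n R) (l k)).[var i].
have LE i k x : mev x (L i k) = (l k).[x ord0 i].
  rewrite /L -(horner_map (mev x)) /= mevX -map_poly_comp.
  by congr (_.[_]); apply: map_poly_id => c _; rewrite /= mevC.
have key (j : nat) : (j <= n)%N -> exists s : seq (mpoly n R * 'rV[R]_n),
    forall x, f x = \sum_(q <- s) f (mix j q.2 x) * mev x q.1.
  elim: j => [_|j IHj jn].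
    exists [:: (1, 0)] => x; rewrite big_seq1 rmorph1 mulr1; congr f.
    by apply/rowP => i; rewrite mxE.
  have [s sE] := IHj (ltnW jn); pose i := Ordinal jn.
  pose g (q : mpoly n R * 'rV[R]_n) (k : nat) : mpoly n R * 'rV[R]_n :=
    (q.1 * L i k, \row_m (if m == i then k%:R else q.2 ord0 m)).
  exists [seq g q k | q <- s, k <- index_iota 0 N.+1].
  move=> x; rewrite sE big_allpairs_dep; apply: eq_bigr => q _.
  rewrite (fE i) big_distrl big_mkord.
  apply: eq_bigr => k _; rewrite /= (rmorphM (mev x)) /= LE mxE ltnn.
  rewrite -mulrA [_.[_] * _]mulrC; congr (f _ * _); apply/rowP => m.
  rewrite !mxE eqxx /= ltnS -(inj_eq val_inj) /=.
  case: ltngtP => mj; rewrite ?mulr0 ?mulr1 ?addr0 //.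
  have -> : m = i by apply: val_inj.
  by rewrite addrC subrK.
have [s sE] := key n (leqnn n).
exists (\sum_(q <- s) f q.2 *: q.1) => x.
rewrite sE (rmorph_sum (mev x)) /=; apply: eq_bigr => q _.
rewrite -mul_mpolyC (rmorphM (mev x)) /= mevC; congr (f _ * _).
by apply/rowP => i; rewrite mxE ltn_ord.
Qed.

Lemma liouville f N (C : R) : harm f -> 0 < C ->
  (forall x, `|f x| <= C * (1 + `|x|) ^+ N) -> exists p, forall x, f x = mev x
    p.
Proof.
move=> hf C0 fC; have [l lP] := frechet_lagrange N.
apply: (separately_poly (N := N) (l := l)) => i x.
(* The line is parametrised by the [i]-th coordinate itself, so the nodes lie on the hyperplanes
   [x_i = k]. *)
pose phi t := f (x - x ord0 i *: dir i + t *: dir i).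
have phiE t : phi t = f (x + (t - x ord0 i) *: dir i).
  by rewrite /phi scalerBl addrA addrAC.
have {1}-> : f x = phi (x ord0 i) by rewrite phiE subrr scale0r addr0.
rewrite (lP phi) => [|t|s t s0].
- by apply: eq_bigr => k _; rewrite phiE.
- have ct : {for t, continuous (fun t : R =>
  x - x ord0 i *: dir i + t *: dir i)}.
    apply: (@continuousD _ _ _ (cst _) (fun t : R => t *: dir i)).
      exact: cst_continuous.
    exact: scalel_continuous.
  apply: (@continuous_comp _ _ _ (fun t : R =>
    x - x ord0 i *: dir i + t *: dir i) f).
    exact: ct.
  exact: hf.1.
- by rewrite /phi -iter_fdiff_line (iter_fdiff_eq0 i hf s0 C0 fC).
Qed.
End Liouville.

(** * Sign of products with a harmonic polynomial *)

Section PolyInfinity.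
Variable R : realType.
Implicit Types (p q : {poly R}).

(** A negative coefficient at the degree bound would be the leading one, and [q] would be negative
    far out. *)
Lemma poly_coef_top_ge0 q d : (size q <= d.+1)%N ->
  (forall t, 0 < t -> 0 <= q.[t]) -> 0 <= q`_d.
Proof.
move=> sq q0; rewrite leNgt; apply/negP => qd.
have dE : d = (size q).-1.
  have [lt|] := leqP (size q) d; last by move: sq; lia.
  by move: qd; rewrite nth_default // ltxx.
have lq : 0 < lead_coef (- q) by rewrite lead_coefN lead_coefE -dE oppr_gt0.
have [y yP] := poly_pinfty_gt_lc lq.
have := yP (Num.max y 1); rewrite le_max lexx => /(_ isT).
have := q0 (Num.max y 1); rewrite lt_max ltr01 orbT => /(_ isT).
by rewrite hornerN; lra.
Qed.
End PolyInfinity.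

(** * Positivity of the resolvent of the Laplacian on polynomials *)

Section WeakPositivity.
Variables (R : realType) (n : nat).
Implicit Types (p q u g : mpoly n R) (x : 'rV[R]_n).

Lemma mev_bound p : exists2 C : R, 0 < C &
  exists N, forall x, `|mev x p| <= C * (1 + `|x|) ^+ N.
Proof.
have pow1 x k : 1 <= (1 + `|x|) ^+ k by rewrite exprn_ege1 // lerDl.
elim/mpoly_ring_ind: p => [c|i|p q [C C0 [N pC]] [C' C'0 [N' qC]]|
                           p q [C C0 [N pC]] [C' C'0 [N' qC]]].
- exists (1 + `|c|); first by rewrite ltr_pwDl.
  by exists 0%N => x; rewrite mevC expr0 mulr1 lerDr.
- exists 1 => //; exists 1%N => x; rewrite mevX mul1r expr1.
  by apply: le_trans (coord_le_norm _ _) _; rewrite lerDr.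
- exists (C + C'); first exact: addr_gt0.
  exists (N + N')%N => x; rewrite rmorphD /=; apply: le_trans (ler_normD _ _) _.
  rewrite mulrDl lerD //.
    by apply: le_trans (pC x) _;
      rewrite ler_pM2l // exprD ler_peMr // (le_trans ler01).
  by apply: le_trans (qC x) _;
    rewrite ler_pM2l // exprD ler_peMl // (le_trans ler01).
- exists (C * C'); first exact: mulr_gt0.
  exists (N + N')%N => x; rewrite rmorphM /= normrM exprD mulrACA.
  exact: ler_pM.
Qed.

(** The truncated exponent is harmless for [k <= 1], where the factor [k * k.-1] is 0. *)
Lemma mlap_varX i k : mlap (var i ^+ k : mpoly n R) = (k * k.-1)%:R *:
  var i ^+ k.-2.
Proof.
have dX j m : mderiv j (var i ^+ m : mpoly n R) = (i == j)%:R * (m%:R *: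
  var i ^+ m.-1).
  elim: m => [|m IHm]; first by rewrite expr0 -mpolyC1 mderivC scale0r mulr0.
  rewrite exprS mderivM mderivXU IHm mulrCA -mulrDr; congr (_ * _).
  case: m {IHm} => [|m] /=; first by rewrite expr0 scale0r mulr0 addr0 scale1r.
  by rewrite -scalerAr -exprS -[X in X + _]scale1r -scalerDl.
rewrite /mlap (bigD1 i) //= big1 ?addr0 => [|j /negbTE ji].
  by rewrite dX eqxx mul1r mderivZ dX eqxx mul1r scalerA -natrM.
by rewrite dX eq_sym ji mul0r mderiv0.
Qed.

(* A small multiple of this is added to the solution of [G - a (mlap G) = p] to
   make it attain its minimum. *)
Definition coercive (N : nat) (a : R) : mpoly n R :=
  \sum_i (var i ^+ (2 * N.+1) +
          mpolyC n ((a * (2 * N.+1 * (2 * N.+1).-1)%:R) ^+ N.+1)).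

Lemma coercive_ge N a x : 0 <= a -> (0 < n)%N ->
  `|x| ^+ (2 * N.+1) <= mev x (coercive N a).
Proof.
move=> a0 n0; rewrite /coercive (rmorph_sum (mev x)) /=.
have K0 : 0 <= (a * (2 * N.+1 * (2 * N.+1).-1)%:R) ^+ N.+1.
  by rewrite exprn_ge0 // mulr_ge0.
have [i ->] : exists i, `|x| = `|x ord0 i|.
  apply: contrapT => /forallNP H.
  have xlt i : `|x ord0 i| < `|x|.
    by rewrite lt_neqAle coord_le_norm andbT; apply/eqP => /esym; exact: H.
  have x0 : 0 < `|x| by apply: le_lt_trans (xlt (Ordinal n0)).
  by have := rV_norm_lt x0 xlt; rewrite ltxx.
have E j : mev x (var j ^+ (2 * N.+1) +
   mpolyC n ((a * (2 * N.+1 * (2 * N.+1).-1)%:R) ^+ N.+1)) =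
   `|x ord0 j| ^+ (2 * N.+1) + (a * (2 * N.+1 * (2 * N.+1).-1)%:R) ^+ N.+1.
  rewrite rmorphD rmorphXn /= mevX mevC; congr (_ + _).
  by rewrite !exprM real_normK ?num_real.
rewrite (bigD1 i) //= E -addrA lerDl addr_ge0 // sumr_ge0 // => j _.
by rewrite E addr_ge0 // exprn_ge0.
Qed.

(** With [t = x_i^2] each summand becomes [t^(N+1) + K^(N+1) - K t^N], and [K t^N] is at most the
    larger of the two powers. *)
Lemma coercive_super N a x : 0 <= a ->
  0 <= mev x (coercive N a) - a * mev x (mlap (coercive N a)).
Proof.
move=> a0; set K : R := a * (2 * N.+1 * (2 * N.+1).-1)%:R.
have K0 : 0 <= K by rewrite mulr_ge0.
rewrite /coercive mlap_sum !(rmorph_sum (mev x)) /= mulr_sumr -sumrB.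
apply: sumr_ge0 => i _; rewrite mlapD mlap_varX -/K.
have -> : mlap (mpolyC n (K ^+ N.+1)) = 0.
  by rewrite /mlap big1 // => j _; rewrite !mderivC.
rewrite addr0 -mul_mpolyC rmorphD !rmorphM !rmorphXn /= !mevC !mevX.
have -> : (2 * N.+1).-2 = (2 * N)%N by lia.
rewrite mulrA -/K !exprM; set t := x ord0 i ^+ 2.
have t0 : 0 <= t by exact: sqr_ge0.
have [Kt|tK] := leP K t.
  rewrite addrAC; apply: addr_ge0; last exact: exprn_ge0.
  by rewrite subr_ge0 exprS ler_wpM2r // exprn_ge0.
rewrite -addrA; apply: addr_ge0; first exact: exprn_ge0.
rewrite subr_ge0 exprS ler_wpM2l //.
by rewrite lerXn2r // ?nnegrE // ltW.
Qed.

(** Minimum principle: at a minimum of [P = G + e B] the Laplacian is nonnegative, while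
    [P - a (mlap P)] equals [p + e (B - a (mlap B))], which is nonnegative. Hence [P] is nonnegative
    there, and [e] is arbitrarily small. *)
Lemma resolvent_ge0 a p G x : 0 < a -> (forall y, 0 <= mev y p) ->
  G - a *: mlap G = p -> 0 <= mev x G.
Proof.
move=> a0 p0 GE; have a0' := ltW a0.
have GEx y : mev y G = mev y p + a * mev y (mlap G).
  by rewrite -GE rmorphB -mul_mpolyC rmorphM /= mevC subrK.
have [n0|n0] := posnP n.
  rewrite GEx (_ : mlap G = 0) ?rmorph0 ?mulr0 ?addr0 //.
  by rewrite /mlap big1 // => -[i ilt]; exfalso; rewrite n0 in ilt.
have [C C0 [N GC]] := mev_bound G.
pose B := coercive N a.
suff eps e : 0 < e -> 0 <= mev x G + e * mev x B.
  rewrite leNgt; apply/negP => Gx.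
  have b0 : 0 < 1 + mev x B.
    by rewrite ltr_pwDl // (le_trans _ (coercive_ge _ _ a0' n0)) // exprn_ge0.
  (* This choice keeps [e * mev x B] below half of [- mev x G]. *)
  pose e := - mev x G / 2 / (1 + mev x B).
  have e0 : 0 < e by rewrite !divr_gt0 // oppr_gt0.
  have := eps e e0.
  have : e * (1 + mev x B) = - mev x G / 2 by rewrite divfK // gt_eqF.
  by lra.
move=> e0; rewrite leNgt; apply/negP => neg.
pose P := G + e *: B.
have PE y : mev y P = mev y G + e * mev y B.
  by rewrite rmorphD -mul_mpolyC rmorphM /= mevC.
(* Beyond this radius the growth of order [2 * N.+1] of [e B] beats the bound of order [N] on [G],
   so a negative minimum lies strictly inside. *)
pose rho := 1 + C * 2 ^+ N / e.
have q0 : 0 <= C * 2 ^+ N / e by rewrite divr_ge0 ?mulr_ge0 ?exprn_ge0 // ltW.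
have far y : rho <= `|y| -> 0 < mev y P.
  move=> yr; have y1 : 1 <= `|y| by move: yr; rewrite /rho; lra.
  have h1 : `|mev y G| <= C * 2 ^+ N * `|y| ^+ N.
    apply: le_trans (GC y) _; rewrite -mulrA ler_pM2l // -exprMn.
    have y2 : 1 + `|y| <= 2 * `|y| by lra.
    by rewrite lerXn2r // nnegrE ?addr_ge0 ?mulr_ge0.
  have yN : 0 < `|y| ^+ N by rewrite exprn_gt0 //; lra.
  have h2 : C * 2 ^+ N * `|y| ^+ N < e * `|y| ^+ (2 * N.+1).
    have -> : (2 * N.+1 = N + N.+2)%N by lia.
    rewrite exprD mulrCA [_ * `|y| ^+ N]mulrC ltr_pM2l //.
    rewrite [e * _]mulrC -ltr_pdivrMr //; apply: (@lt_le_trans _ _ rho).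
      by rewrite /rho; lra.
    by apply: le_trans yr _; rewrite exprS ler_peMr // ?exprn_ege1 //; lra.
  have h3 : e * `|y| ^+ (2 * N.+1) <= e * mev y B by rewrite ler_pM2l //
    coercive_ge.
  by rewrite PE; move: h1; rewrite ler_norml => /andP[h1 _]; lra.
pose K := [set y : 'rV[R]_n | `|y| <= rho].
have cK : compact K.
  apply: bounded_closed_compact.
    by exists rho; split; [exact: num_real|move=> b rb y /= yr;
      apply: le_trans (ltW rb)].
  apply: (@preimage_closed _ _ (fun y : 'rV[R]_n => `|y|) [set t | t <= rho]).
    by move=> y _; exact: norm_continuous.
  exact: closed_le.
have xK : K x.
  by rewrite /K /= leNgt; apply/negP => /ltW /far; rewrite PE; lra.
have [c /[!inE] /= cr cmin] :
  exists2 c, c \in K & forall t, t \in K -> mev c P <= mev t P.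
  apply: EVT_min_rV => //; first by exists x.
  exact/continuous_subspaceT/continuous_mev.
have Pc : mev c P < 0.
  by apply: le_lt_trans (cmin x _) _; rewrite ?inE // PE.
have clt : `|c| < rho by rewrite ltNge; apply/negP => /far; lra.
have d0 : 0 < rho - `|c| by rewrite subr_gt0.
have lapP : 0 <= mev c (mlap P).
  have := laplacian_le0_at_max (has_laplacianZ (-1) (has_laplacian_mev P)) d0
    (x := c).
  rewrite /= [-1 * mev c (mlap P)]mulN1r oppr_le0; apply => y yc;
    rewrite !mulN1r lerN2; apply: cmin.
  rewrite inE /K /=.
  by have := ler_normD (y - c) c; rewrite subrK; lra.
have := coercive_super N c a0'; rewrite -/B => sB.
have lapE : mev c (mlap P) = mev c (mlap G) + e * mev c (mlap B).
  by rewrite mlapD mlapZ rmorphD -mul_mpolyC rmorphM /= mevC.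
have : 0 <= a * mev c (mlap P) by rewrite mulr_ge0.
have : 0 <= e * (mev c B - a * mev c (mlap B)) by rewrite mulr_ge0 // ltW.
have := p0 c; move: Pc; rewrite PE GEx lapE.
lra.
Qed.

(** The finite Neumann sum of the [a^j L^j p] for [j <= K] solves [G - a (mlap G) = p], because the
    next iterate is 0. It is nonnegative for every [a > 0], hence so is its coefficient of [a^K]. *)
Lemma iter_mlap_ge0 K p x : (forall y, 0 <= mev y p) ->
  iter K.+1 (@mlap R n) p = 0 -> 0 <= mev x (iter K (@mlap R n) p).
Proof.
move=> p0 pK.
pose q := \poly_(j < K.+1) mev x (iter j (@mlap R n) p).
have qK : q`_K = mev x (iter K (@mlap R n) p) by rewrite coef_poly leqnn.
rewrite -qK; apply: poly_coef_top_ge0; first exact: size_poly.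
move=> a a0; pose G := \sum_(j < K.+1) a ^+ j *: iter j (@mlap R n) p.
have -> : q.[a] = mev x G.
  rewrite /q horner_poly /G (rmorph_sum (mev x)); apply: eq_bigr => j _ /=.
  by rewrite -mul_mpolyC rmorphM /= mevC mulrC.
apply: (resolvent_ge0 _ a0 p0); rewrite {}/G.
suff -> k : \sum_(j < k) a ^+ j *: iter j (@mlap R n) p
    - a *: mlap (\sum_(j < k) a ^+ j *: iter j (@mlap R n) p) =
    p - a ^+ k *: iter k (@mlap R n) p by rewrite pK scaler0 subr0.
elim: k => [|k IHk].
  by rewrite !big_ord0 mlap0 scaler0 expr0 scale1r subr0 subrr.
rewrite !big_ord_recr /= mlapD scalerDr opprD addrACA IHk mlapZ scalerA -exprS.
by rewrite addrA subrK.
Qed.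

Lemma mlapM p q : mlap (p * q) = mlap p * q
  + 2 *: \sum_i mderiv i p * mderiv i q + p * mlap q.
Proof.
rewrite /mlap mulr_suml mulr_sumr scaler_sumr -!big_split;
  apply: eq_bigr => i _.
by rewrite /= mderivM mderivD !mderivM scaler_nat mulr2n !addrA.
Qed.

Lemma mderiv_mlap i p : mlap (mderiv i p) = mderiv i (mlap p).
Proof.
rewrite /mlap (raddf_sum (mderiv i)) /=; apply: eq_bigr => j _.
by rewrite (mderiv_comm i j) (mderiv_comm i j).
Qed.

Lemma msize_leP p k :
  (mmeasure mdeg p <= k)%N <-> forall m, mcoeff m p != 0 -> (mdeg m < k)%N.
Proof.
split=> [pk m mp|H].
  by apply: leq_trans pk; apply: msize_mdeg_lt; rewrite mcoeff_msupp.
have [->|p0] := eqVneq p 0; first by rewrite mmeasure0.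
by rewrite -mlead_deg //; apply: H; rewrite mleadc_eq0.
Qed.

Lemma msize_mderiv i p k :
  (mmeasure mdeg p <= k.+1)%N -> (mmeasure mdeg (mderiv i p) <= k)%N.
Proof.
move=> /msize_leP pk; apply/msize_leP => m.
rewrite mcoeff_deriv mulrn_eq0 /= => /pk.
by rewrite mdegD mdeg1 addn1.
Qed.

Lemma iter_mlapD k p q :
  iter k (@mlap R n) (p + q) = iter k (@mlap R n) p + iter k (@mlap R n) q.
Proof. by elim: k => //= k ->; rewrite mlapD. Qed.

Lemma iter_mlapZ k c p : iter k (@mlap R n) (c *: p) = c *:
  iter k (@mlap R n) p.
Proof. by elim: k => //= k ->; rewrite mlapZ. Qed.

Lemma iter_mlap0 k : iter k (@mlap R n) 0 = 0.
Proof. by elim: k => //= k ->; rewrite mlap0. Qed.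

(* Each Laplacian differentiates [g] at least once. *)
Lemma iter_mlap_harmonicM m u g : mlap u = 0 -> (mmeasure mdeg g <= m)%N ->
  iter m (@mlap R n) (u * g) = 0.
Proof.
elim: m u g => [|m IHm] u g hu gm.
  by move: gm; rewrite leqn0 mmeasure_poly_eq0 => /eqP ->; rewrite mulr0.
rewrite iterSr mlapM hu mul0r add0r iter_mlapD iter_mlapZ.
rewrite (big_morph _ (iter_mlapD m) (iter_mlap0 m)) big1 => [|i _].
  rewrite scaler0 add0r IHm // /mlap.
  apply: leq_trans (mmeasure_sum _ _ _ _) _; apply/bigmax_leqP => i _.
  by apply/msize_mderiv/leqW/msize_mderiv.
apply: IHm; last exact: msize_mderiv.
by rewrite mderiv_mlap hu mderiv0.
Qed.

(** Here [q] is the part of [p] of degree [D - k], written additively to avoid truncated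
    subtraction; the Laplacian lowers degrees by two. *)
Lemma mcoeff_mlap_homog p q D k :
  (forall m, mcoeff m q = if (mdeg m + k == D)%N then mcoeff m p else 0) ->
  forall m, mcoeff m (mlap q) =
    if (mdeg m + k.+2 == D)%N then mcoeff m (mlap p) else 0.
Proof.
move=> qp m; rewrite /mlap !raddf_sum /=.
have E i : mcoeff m (mderiv i (mderiv i q)) =
    if (mdeg m + k.+2 == D)%N then mcoeff m (mderiv i (mderiv i p)) else 0.
  rewrite !mcoeff_deriv qp !mdegD !mdeg1.
  by rewrite (_ : mdeg m + 1 + 1 + k = mdeg m + k.+2)%N; [case: ifP;
    rewrite ?mul0rn|lia].
by rewrite (eq_bigr _ (fun i _ => E i)); case: ifP => // _; rewrite big1.
Qed.

Definition dirderiv (c : 'I_n -> R) p : mpoly n R := \sum_i c i *: mderiv i p.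

Lemma mlap_dirderiv c p : mlap p = 0 -> mlap (dirderiv c p) = 0.
Proof.
move=> hp; rewrite /dirderiv mlap_sum big1 // => i _.
by rewrite mlapZ mderiv_mlap hp mderiv0 scaler0.
Qed.

(* Testing against squares of linear forms: a nonnegative harmonic polynomial
   is convex. *)
Lemma harmonic_ge0_convex u c x : mlap u = 0 -> (forall y, 0 <= mev y u) ->
  0 <= mev x (dirderiv c (dirderiv c u)).
Proof.
move=> hu u0; pose b : mpoly n R := \sum_i c i *: var i.
have db i : mderiv i b = mpolyC n (c i).
  rewrite /b (raddf_sum (mderiv i)) /= (bigD1 i) //= big1 => [|j /negbTE ji].
    by rewrite mderivZ mderivXU eqxx addr0 -mul_mpolyC mulr1.
  by rewrite mderivZ mderivXU ji scaler0.
have lb : mlap b = 0.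
  by rewrite /mlap big1 // => i _; rewrite db mderivC.
have grad p : \sum_i mderiv i p * mderiv i b = dirderiv c p.
  by apply: eq_bigr => i _; rewrite db mulrC mul_mpolyC.
have lapb p : mlap p = 0 -> mlap (p * b) = 2 *: dirderiv c p.
  by move=> hp; rewrite mlapM hp lb mul0r mulr0 addr0 add0r grad.
have [k kE] : exists k : R, mlap (b * b) = mpolyC n k.
  exists (2 * \sum_i c i * c i); rewrite lapb //.
  rewrite -mul_mpolyC mpolyCM; congr (_ * _);
    rewrite (raddf_sum (@mpolyC n R)) /=.
  by apply: eq_bigr => i _; rewrite db mpolyCM mul_mpolyC.
have E1 : mlap (u * (b * b)) = 4 *: (dirderiv c u * b) + k *: u.
  rewrite mlapM hu mul0r add0r kE [u * _]mulrC mul_mpolyC; congr (_ + _).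
  have -> : 4 = 2 * 2 :> R by ring.
  rewrite -scalerA; congr (_ *: _).
  rewrite -grad [X in 2 *: X]mulr_suml scaler_sumr; apply: eq_bigr => i _.
  by rewrite mderivM db scaler_nat; ring.
have E2 : iter 2 (@mlap R n) (u * (b * b)) = 8 *: dirderiv c (dirderiv c u).
  rewrite /= E1 mlapD !mlapZ hu scaler0 addr0 lapb; last exact: mlap_dirderiv.
  by rewrite scalerA -natrM.
(* The product is nonnegative and a third Laplacian kills it, so its second Laplacian is
   nonnegative. *)
have : 0 <= mev x (iter 2 (@mlap R n) (u * (b * b))).
  apply: iter_mlap_ge0 => [y|].
    by rewrite !(rmorphM (mev y)) /= mulr_ge0 // -expr2 sqr_ge0.
  rewrite iterS E2 mlapZ mlap_dirderiv ?scaler0 //.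
  exact: mlap_dirderiv.
by rewrite E2 -mul_mpolyC (rmorphM (mev x)) /= mevC pmulr_rge0.
Qed.
End WeakPositivity.

(** * Nonnegative harmonic forms and products of constant sign *)

Section HarmonicSign.
Variables (R : realType) (n : nat).
Implicit Types (p q u g Q : mpoly n R) (x : 'rV[R]_n).

Lemma evp_size x (P : {poly mpoly n R}) : (size (evp x P) <= size P)%N.
Proof. exact: size_poly. Qed.

Lemma mev_top_ge0 p x : (forall y, 0 <= mev y p) -> 0 <= mev x (top p).
Proof.
move=> p0; pose q := evp 0 (shiftp x p).
have -> : mev x (top p) = q`_(mmeasure mdeg p).-1.
  by rewrite /q /evp coef_map shiftp_top /= mevC.
apply: poly_coef_top_ge0 => [|t _]; last by rewrite evp_shiftp.
exact: leq_trans (evp_size _ _) (leq_trans (shiftp_size _ _) (leqSpred _)).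
Qed.

Lemma multinom_pred (m : multinom n) : mdeg m != 0%N ->
  exists i m', m = mnm_add m' (mnm1 i).
Proof.
rewrite mdeg_eq0 => m0; have [i mi] : exists i, m i != 0%N.
  apply/existsP; apply: contraNT m0 => /existsPn m0.
  by apply/eqP/mnmP => i; rewrite mnm0E; apply/eqP; rewrite -[_ == _]negbK.
by exists i, (mnm_sub m (mnm1 i)); rewrite submK // lep1mP.
Qed.

(** By convexity the pure second derivatives are nonnegative; they sum to 0, so each vanishes.
    Convexity along [e_i + s e_j] with [s = 1] and [s = -1] then leaves both signs of the mixed
    derivative nonnegative. *)
Lemma harmonic_ge0_deriv2 Q i j : mlap Q = 0 -> (forall y, 0 <= mev y Q) ->
  mderiv j (mderiv i Q) = 0.
Proof.
move=> hQ Q0.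
have dirE (k : 'I_n) p : dirderiv (fun l => (l == k)%:R) p = mderiv k p.
  rewrite /dirderiv (bigD1 k) //= eqxx scale1r big1 ?addr0 // => l /negbTE ->.
  by rewrite scale0r.
have sq0 k : mderiv k (mderiv k Q) = 0.
  apply: mev_eq0 => x.
  have sq_ge0 l : 0 <= mev x (mderiv l (mderiv l Q)).
    by have := harmonic_ge0_convex (fun m => (m == l)%:R) x hQ Q0;
      rewrite !dirE.
  have := congr1 (mev x) hQ;
    rewrite /mlap rmorph0 (rmorph_sum (mev x)) /= => /eqP.
  by rewrite psumr_eq0 // => /allP /(_ k (mem_index_enum _)) /eqP.
have pm (s : R) : s ^+ 2 = 1 -> forall x, 0 <= s * mev x (mderiv j (mderiv i
  Q)).
  move=> s2 x.
  have := harmonic_ge0_convex (fun l => (l == i)%:R + s * (l == j)%:R) x hQ Q0.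
  have dE p : dirderiv (fun l => (l == i)%:R + s * (l == j)%:R) p =
      mderiv i p + s *: mderiv j p.
    rewrite -!dirE /dirderiv scaler_sumr -big_split /=.
    by apply: eq_bigr => l _; rewrite scalerDl scalerA.
  rewrite !dE !mderivD !mderivZ !sq0 (mderiv_comm j i) scaler0 addr0 add0r.
  rewrite -scalerDr -mul_mpolyC (rmorphM (mev x)) rmorphD /= mevC.
  by rewrite -mulr2n mulrnAr pmulrn_lge0.
apply: mev_eq0 => x; apply/eqP; rewrite eq_le; apply/andP; split.
  by rewrite -oppr_ge0 -mulN1r pm // sqrrN expr1n.
by rewrite -[mev x _]mul1r pm // expr1n.
Qed.

(** With all second derivatives 0 and no constant term, [Q] is linear, hence odd, and an odd
    nonnegative function is 0. *)
Lemma harmonic_ge0_homog_eq0 Q d : mlap Q = 0 -> (forall y, 0 <= mev y Q) ->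
  (0 < d)%N -> (forall m, mcoeff m Q != 0 -> mdeg m = d) -> Q = 0.
Proof.
move=> hQ Q0 d0 Qd.
have Q1 m : mcoeff m Q != 0 -> mdeg m = 1%N.
  move=> mQ; have [i [m' mE]] : exists i m', m = mnm_add m' (mnm1 i).
    by apply: multinom_pred; rewrite Qd // -lt0n.
  have [m0|] := eqVneq (mdeg m') 0%N; first by rewrite mE mdegD mdeg1 m0.
  move=> /multinom_pred [j [m'' m'E]].
  have := congr1 (mcoeff m'') (harmonic_ge0_deriv2 i j hQ Q0).
  rewrite !mcoeff_deriv mcoeff0 -m'E -mE => /eqP.
  by rewrite !mulrn_eq0 (negbTE mQ).
have odd x : mev (- x) Q = - mev x Q.
  rewrite /mev !mevalE -sumrN big_seq [RHS]big_seq; apply: eq_bigr => m.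
  rewrite mcoeff_msupp => /Q1 md; rewrite -mulrN; congr (_ * _).
  rewrite (eq_bigr (fun i => (-1) ^+ m i * x ord0 i ^+ m i)); last first.
    by move=> i _; rewrite mxE; exact: exprNn.
  by rewrite big_split /= -expr_sum -mdegE md expr1 mulN1r.
apply: mev_eq0 => x; apply: le_anti; rewrite Q0 andbT.
by rewrite -oppr_ge0 -odd.
Qed.

Lemma mcoeff_iter_mlap_top p j m : mcoeff m (iter j (@mlap R n) (top p)) =
  if (mdeg m + 2 * j == (mmeasure mdeg p).-1)%N
  then mcoeff m (iter j (@mlap R n) p) else 0.
Proof.
elim: j m => [|j IHj] m; first by rewrite muln0 addn0 mcoeff_top.
by rewrite !iterS (mcoeff_mlap_homog IHj) mulnS.
Qed.

Lemma harmonic_mul_sign u g : mlap u = 0 -> g != 0 ->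
  (mmeasure mdeg g < mmeasure mdeg u)%N ->
  ~ (forall x, 0 <= mev x u * mev x g).
Proof.
move=> hu g0 gu ug0.
have u0 : u != 0 by rewrite -(mmeasure_poly_eq0 mdeg) -lt0n (leq_ltn_trans _
  gu).
have p0 : u * g != 0 by rewrite mulf_neq0.
have szp : mmeasure mdeg (u * g) = (mmeasure mdeg u + mmeasure mdeg g).-1.
  exact: msizeM.
have top0 : forall x, 0 <= mev x (top (u * g)).
  by move=> x; apply: mev_top_ge0 => y; rewrite rmorphM; exact: ug0.
have fin : exists K, iter K (@mlap R n) (top (u * g)) == 0.
  exists (mmeasure mdeg g); apply/eqP/mpolyP => m.
  by rewrite mcoeff_iter_mlap_top iter_mlap_harmonicM // mcoeff0 if_same.
(* The last nonzero iterate [L^j] of the top form is harmonic, nonnegative and homogeneous. Its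
   degree is positive because [j] is at most [deg g] and [deg g < deg u]. *)
have [[|j] /eqP jP jmin] := ex_minnP fin.
  by have := top_neq0 p0; rewrite -[top _]/(iter 0 (@mlap R n) _) jP eqxx.
have jg : (j < mmeasure mdeg g)%N.
  apply: jmin; apply/eqP/mpolyP => m.
  by rewrite mcoeff_iter_mlap_top iter_mlap_harmonicM // mcoeff0 if_same.
suff /eqP /jmin : iter j (@mlap R n) (top (u * g)) = 0 by rewrite ltnn.
apply: (@harmonic_ge0_homog_eq0 _ ((mmeasure mdeg (u * g)).-1 - 2 * j)) => //.
- by move=> x; apply: iter_mlap_ge0.
- by rewrite szp; lia.
- by move=> m; rewrite mcoeff_iter_mlap_top; case: ifP => [/eqP <-|_];
  rewrite ?addnK ?eqxx.
Qed.
End HarmonicSign.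

(** * Divisibility *)

Section Gauss.

(** Induction on the degree of [c]. At a root [a] of [c] the product [F * Q] vanishes, so ['X - a]
    divides all coefficients of [F] or all those of [Q] and can be cancelled. Once [c] is constant,
    the leading coefficient of [F] divides a nonzero constant. *)
Lemma gauss_closed (k : closedFieldType) (c : {poly k}) (U F Q :
  {poly {poly k}})
    (l : k) : c != 0 -> l != 0 -> lead_coef U = l%:P -> c *: U = F * Q ->
  forall j, (lead_coef F %| F`_j)%R.
Proof.
move=> + l0 lU; have [m] := ubnP (size c).
elim: m => // m IHm in c F Q * => /ltnSE sc c0 cU j.
have [c1|] := eqVneq (size c) 1%N.
  have lFQ : lead_coef F * lead_coef Q = c * l%:P.
    by rewrite -lead_coefM -cU lead_coefZ lU.
  have /eqp_dvdr E : c * l%:P %= 1.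
    by rewrite -size_poly_eq1 mulrC mul_polyC size_scale // c1.
  have : (lead_coef F %| 1)%R by rewrite -E -lFQ dvdp_mulr.
  by move=> /dvdp_trans; apply; exact: dvd1p.
move=> /closed_rootP [a /factor_theorem [c' cE]].
have X0 : 'X - a%:P != 0 by rewrite polyXsubC_eq0.
have c'0 : c' != 0 by apply: contraNneq c0 => c'0; rewrite cE c'0 mul0r.
have sc' : (size c' < m)%N.
  by apply: leq_trans sc;
    rewrite cE size_Mmonic ?monicXsubC // size_XsubC addn2.
have fact (P : {poly {poly k}}) : map_poly (horner_eval a) P = 0 ->
    exists P', P = ('X - a%:P) *: P'.
  move=> P0; exists (\poly_(i < size P) (P`_i %/ ('X - a%:P))).
  apply/polyP => i; rewrite coefZ coef_poly; case: ltnP => iP; last first.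
    by rewrite mulr0 nth_default.
  rewrite mulrC divpK // dvdp_XsubCl /root.
  by have := congr1 (fun p : {poly k} => p`_i) P0;
    rewrite coef_map coef0 /= => /eqP.
have : map_poly (horner_eval a) F * map_poly (horner_eval a) Q = 0.
  rewrite -rmorphM -cU -mul_polyC rmorphM /= map_polyC /= /horner_eval cE.
  by rewrite hornerM hornerXsubC subrr mulr0 mul0r.
move=> /eqP; rewrite mulf_eq0 => /orP[] /eqP /fact [P' PE].
  have cU' : c' *: U = P' * Q.
    apply: (@mulfI _ ('X - a%:P)%:P); first by rewrite polyC_eq0.
    by rewrite !mul_polyC scalerA mulrC -cE cU PE scalerAl.
  rewrite PE coefZ lead_coefZ dvdp_mul2l //.
  exact: (IHm c' P' Q).
apply: (IHm c' F P') => //.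
apply: (@mulfI _ ('X - a%:P)%:P); first by rewrite polyC_eq0.
by rewrite !mul_polyC scalerA mulrC -cE cU PE scalerAr.
Qed.

(** Roots are found over the complex extension, and divisibility descends to the real field. *)
Lemma gauss_real (R : rcfType) (c : {poly R}) (U F Q : {poly {poly R}})
    (l : R) : c != 0 -> l != 0 -> lead_coef U = l%:P -> c *: U = F * Q ->
  forall j, (lead_coef F %| F`_j)%R.
Proof.
move=> c0 l0 lU cU j.
pose f := real_complex R; pose ff := map_poly f.
have H : map_poly ff (c *: U) = map_poly ff F * map_poly ff Q.
  by rewrite cU rmorphM.
have lm (P : {poly {poly R}}) : lead_coef (map_poly ff P) = ff (lead_coef P).
  by apply: lead_coef_map_inj; [exact: map_poly_inj|exact: rmorph0].
rewrite -(dvdp_map f) -[map_poly f (lead_coef F)]lm -[map_poly f F`_j]coef_map.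
apply: (@gauss_closed _ (ff c) (map_poly ff U) _ (map_poly ff Q) (f l)).
- by rewrite map_poly_eq0.
- by rewrite fmorph_eq0.
- by rewrite lm lU /= /ff map_polyC.
- by rewrite -H -!mul_polyC rmorphM /= map_polyC.
Qed.
Lemma gauss_rmorphism (A : comNzRingType) (R : rcfType)
    (f : {rmorphism A -> {poly R}}) (c : A) (U F Q : {poly A}) (l : R) :
  f c != 0 -> f (lead_coef F) != 0 -> l != 0 -> f (lead_coef U) = l%:P ->
  c *: U = F * Q -> forall j, (f (lead_coef F) %| f F`_j)%R.
Proof.
move=> c0 F0 l0 lU cU j.
have U0 : f (lead_coef U) != 0 by rewrite lU polyC_eq0.
rewrite -(lead_coef_map_eq F0) -coef_map.
apply: (@gauss_real _ (f c) (map_poly f U) _ (map_poly f Q) l) => //.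
  by rewrite -lU; exact: lead_coef_map_eq.
by rewrite -rmorphM -cU -!mul_polyC rmorphM /= map_polyC.
Qed.
End Gauss.

(** * Gauss's lemma in several variables *)

Section Normality.
Variables (R : realType) (n : nat).
Implicit Types (b c : mpoly n R) (U F Q G : {poly mpoly n R}).

Lemma mpoly_factor_const b c (k : R) : k != 0 -> b * c = mpolyC n k ->
  exists2 l : R, l != 0 & b = mpolyC n l.
Proof.
move=> k0 bc.
have kn0 : mpolyC n k != 0 by rewrite mpolyC_eq0.
have b0 : b != 0 by apply: contraNneq kn0 => b0; rewrite -bc b0 mul0r.
have c0 : c != 0 by apply: contraNneq kn0 => c0; rewrite -bc c0 mulr0.
apply/msize_poly1P; have := msizeM b0 c0; rewrite bc msizeC k0.
have := mpolySpred mdeg b0; have := mpolySpred mdeg c0.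
by move=> -> -> /=; lia.
Qed.

(** In a suitable direction [e], the leading coefficient [b] of [F] restricts to every line as a
    nonzero polynomial in [t], so the one-variable lemma gives divisibility line by line. Dividing
    by [b (x + t e)], made monic in [t], turns this into one identity over all [x]. *)
Lemma mpoly_normal c U F Q (l : R) : c != 0 -> l != 0 ->
  lead_coef U = mpolyC n l -> c *: U = F * Q -> exists G, F = lead_coef F *: G.
Proof.
move=> c0 l0 lU cU; set b := lead_coef F.
have U0 : U != 0 by rewrite -lead_coef_eq0 lU mpolyC_eq0.
have F0 : F != 0.
  apply/eqP => F0; move: cU; rewrite F0 mul0r => /eqP.
  by rewrite scale_poly_eq0 (negbTE c0) (negbTE U0).
have b0 : b != 0 by rewrite lead_coef_eq0.
have bc0 : b * c != 0 by rewrite mulf_neq0.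
have [e te] := mev_neq0 (top_neq0 bc0).
have [_ lbc] := shiftp_lead te.
have [k k0 lb] : exists2 k : R, k != 0 & lead_coef (shiftp e b) = mpolyC n k.
  by apply: (mpoly_factor_const te); rewrite -lbc rmorphM lead_coefM.
have [k' k'0 lc] : exists2 k : R, k != 0 & lead_coef (shiftp e c) = mpolyC n k.
  by apply: (mpoly_factor_const te); rewrite -lbc mulrC rmorphM lead_coefM.
pose B := mpolyC n k^-1 *: shiftp e b.
have Bm : B \is monic.
  by rewrite monicE lead_coefZ lb -mpolyCM mulVf // mpolyC1.
have dvd x j : evp x (shiftp e b) %| evp x (shiftp e F`_j).
  pose kap : {rmorphism mpoly n R -> {poly R}} := evp x \o shiftp e.
  have kb : kap b != 0.
    by rewrite -lead_coef_eq0 /= /evp lead_coef_map_eq /= lb mevC.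
  have kc : kap c != 0.
    by rewrite -lead_coef_eq0 /= /evp lead_coef_map_eq /= lc mevC.
  apply: (gauss_rmorphism (f := kap) kc kb l0 _ cU).
  by rewrite lU /= shiftpC /evp map_polyC /= mevC.
have div j : exists g, F`_j = b * g.
  pose q := Pdiv.Ring.rdivp (shiftp e F`_j) B.
  pose r := Pdiv.Ring.rmodp (shiftp e F`_j) B.
  have qr : shiftp e F`_j = q * B + r := Pdiv.RingMonic.rdivp_eq Bm _.
  have r0 : r = 0.
    apply: evp_inj => x t; rewrite rmorph0 horner0.
    suff -> : evp x r = 0 by rewrite horner0.
    have evB : evp x B = k^-1 *: evp x (shiftp e b).
      by rewrite /B -mul_polyC rmorphM /= {1}/evp map_polyC /= mevC mul_polyC.
    have dr : evp x B %| evp x r.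
      rewrite evB dvdpZl ?invr_eq0 //.
      have -> : evp x r = evp x (shiftp e F`_j) - evp x q * evp x B.
        by rewrite qr rmorphD rmorphM /= addrC addKr.
      by rewrite dvdp_sub // evB -scalerAr dvdpZr ?invr_eq0 // dvdp_mulIr.
    apply/eqP/negPn/negP => er0; have := dvdp_leq er0 dr.
    have -> : size (evp x B) = size B.
      by rewrite size_map_poly_id0 // (monicP Bm) rmorph1 oner_neq0.
    rewrite leqNgt => /negP; apply; apply: leq_ltn_trans (evp_size _ _) _.
    by rewrite Pdiv.Ring.ltn_rmodp monic_neq0.
  (* The quotient in the original variables is read off at [t = 0]. *)
  exists (mpolyC n k^-1 * q.[0]); apply: mev_inj => x.
  have := congr1 (fun P => (evp x P).[0]) qr.
  rewrite r0 addr0 evp_shiftp scale0r addr0 => ->.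
  rewrite /B -mul_polyC !rmorphM /= !hornerM evp_shiftp scale0r addr0.
  rewrite {2}/evp map_polyC hornerC /= !mevC.
  rewrite -[X in (evp x q).[X]](rmorph0 (mev x)) /evp horner_map /=; ring.
have [g gP] := choice div.
exists (\poly_(j < size F) g j); apply/polyP => j.
rewrite coefZ coef_poly; case: ltnP => jF; first exact: gP.
by rewrite mulr0 nth_default.
Qed.
End Normality.

Section RealPolySign.
Variable R : realType.
Implicit Types p q w : {poly R}.

Lemma poly_ge0_dense q w : w != 0 -> (forall t, w.[t] != 0 -> 0 <= q.[t]) ->
  forall t, 0 <= q.[t].
Proof.
move=> w0 qw t; rewrite leNgt; apply/negP => qt.
have Nq : 0 < - q.[t] by rewrite oppr_gt0.
have [d d0 dP] := poly_cont t q Nq.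
move/eqP: w0; apply.
(* These infinitely many points lie within [d] of [t], where [q] stays negative, so all would be
   roots of [w]. *)
pose y (k : nat) : R := t + d / k.+2%:R.
have yI : injective y.
  move=> i j /addrI /(mulfI (lt0r_neq0 d0)) /invr_inj /eqP.
  by rewrite eqr_nat => /eqP [].
apply: (@roots_geq_poly_eq0 _ _ [seq y i | i <- iota 0 (size w)]).
- rewrite all_map; apply/allP => k _ /=; apply: contraTT isT => /= wk.
  have yk : `|y k - t| < d.
    rewrite /y addrAC subrr add0r gtr0_norm ?divr_gt0 //.
    by rewrite ltr_pdivrMr // ltr_pMr // ltr1n.
  have := dP _ yk; rewrite ltr_norml => /andP[_].
  by have := qw (y k) wk; lra.
- by rewrite map_inj_uniq ?iota_uniq.
- by rewrite size_map size_iota.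
Qed.

Lemma poly_noroot_sign p : (forall t, p.[t] != 0) -> 0 < lead_coef p * p.[0].
Proof.
move=> nr; rewrite ltNge; apply/negP => p0.
have l0 : lead_coef p != 0.
  by rewrite lead_coef_eq0; apply: contraNneq (nr 0) => ->; rewrite horner0.
pose p' := lead_coef p *: p.
have l2 : 0 < lead_coef p' by rewrite lead_coefZ -expr2 exprn_even_gt0.
have [y yP] := poly_pinfty_gt_lc l2.
have M0 : 0 <= Num.max y 0 by rewrite le_max lexx orbT.
have pM : 0 < p'.[Num.max y 0].
  by apply: lt_le_trans l2 (yP _ _); rewrite le_max lexx.
have [|z _] := poly_ivt M0 (p := p').
  by rewrite (ltW pM) andbT hornerZ.
by rewrite rootE hornerZ mulf_eq0 (negbTE l0) (negbTE (nr z)).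
Qed.
End RealPolySign.

(** * Divisibility by a harmonic polynomial *)

Section HarmonicDivides.
Variables (R : realType) (n : nat).
Implicit Types (p u h b : mpoly n R) (x e : 'rV[R]_n).
Implicit Types (P Q F G H : {poly mpoly n R}).

(** On the line joining [x] to a point where [b] is nonzero, [b] has only finitely many zeros. *)
Lemma mev_ge0_dense h b : b != 0 -> (forall x, mev x b != 0 -> 0 <= mev x h) ->
  forall x, 0 <= mev x h.
Proof.
move=> /mev_neq0 [z bz] hb x.
have -> : mev x h = (evp x (shiftp (z - x) h)).[0].
  by rewrite evp_shiftp scale0r addr0.
apply: (@poly_ge0_dense _ _ (evp x (shiftp (z - x) b))) => [|t].
  apply: contraNneq bz => bz.
  have := evp_shiftp x (z - x) b 1; rewrite bz horner0 scale1r addrC subrK.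
  by move <-.
by rewrite !evp_shiftp; exact: hb.
Qed.

(* [unshift e P] is the polynomial [P (x - t e, t)]. *)
Definition unshift e P : {poly mpoly n R} := (map_poly (shiftp (- e)) P).['X].

HB.instance Definition _ e := GRing.RMorphism.copy (unshift e)
  (horner_eval 'X \o map_poly (shiftp (- e))).

Lemma evp_unshift e x t P : (evp x (unshift e P)).[t] = (evp (x - t *:
  e) P).[t].
Proof.
rewrite /unshift -(horner_map (evp x)) /= {2}/evp map_polyX.
have := horner_map (horner_eval t : {rmorphism {poly R} -> R})
  (map_poly (evp x) (map_poly (shiftp (- e)) P)) 'X.
rewrite /= {2 3}/horner_eval hornerX => <-.
congr (_.[_]); rewrite -!map_poly_comp; apply: eq_map_poly => q /=.
by rewrite /horner_eval evp_shiftp scalerN.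
Qed.

Theorem harmonic_divides u p h : u != 0 -> mlap u = 0 ->
  (forall x, `|mev x p| <= mev x h * `|mev x u|) -> exists r, p = u * r.
Proof.
move=> u0 hu ph.
have [e te] := mev_neq0 (top_neq0 u0).
have [_ lU] := shiftp_lead te.
set l := mev e (top u) in te lU; set U := shiftp e u in lU.
have U0 : U != 0 by rewrite -lead_coef_eq0 lU mpolyC_eq0.
pose J F := exists H, forall x t,
  `|(evp x F).[t]| <= (evp x H).[t] * `|(evp x U).[t]|.
have JU : J U by exists 1 => x t; rewrite rmorph1 hornerC mul1r.
have JP : J (shiftp e p).
  by exists (shiftp e h) => x t; rewrite !evp_shiftp.
have JD F F' : J F -> J F' -> J (F + F').
  move=> [H HP] [H' HP']; exists (H + H') => x t.
  rewrite !rmorphD !hornerD mulrDl /=; apply: le_trans (ler_normD _ _) _.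
  exact: lerD.
(* The dominating factor must stay polynomial, so [|Q|] is replaced by [1 + Q^2]. *)
have JM F Q : J F -> J (Q * F).
  move=> [H HP]; exists ((1 + Q ^+ 2) * H) => x t.
  rewrite !rmorphM rmorphD rmorph1 rmorphXn !hornerE normrM -mulrA.
  apply: ler_pM; [by []|by []| |exact: HP].
  set a := _.[t].
  have : 0 <= (`|a| - 1) ^+ 2 by exact: sqr_ge0.
  have : 0 <= `|a| by exact: normr_ge0.
  by rewrite -(real_normK (num_real a)) !expr2; nra.
have JB F F' Q : J F -> J F' -> J (F - Q * F').
  by move=> JF JF'; apply: JD => //; rewrite -mulNr; exact: JM.
have ex_m : exists m, `[< exists F, [/\ J F, F != 0 & size F = m] >].
  by exists (size U); apply/asboolP; exists U.
have [_ /asboolP[F [JF F0 <-]] Fmin] := ex_minnP ex_m.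
have small r : J r -> (size r < size F)%N -> r = 0.
  move=> Jr rF; apply/eqP/negPn/negP => r0.
  have /Fmin : `[< exists F, [/\ J F, F != 0 & size F = size r] >].
    by apply/asboolP; exists r.
  by rewrite leqNgt rF.
set b := lead_coef F.
have b0 : b != 0 by rewrite lead_coef_eq0.
(* The remainder of the pseudo-division stays in the ideal and is smaller than [F], so it is 0. *)
have pseudo W : J W -> exists k Q, b ^+ k *: W = Q * F.
  move=> JW; have := Pdiv.Idomain.divp_eq W F; rewrite -/b.
  set k := scalp _ _; set Q := (W %/ F)%R; set r := (W %% F)%R => E.
  exists k, Q; rewrite E (_ : r = 0) ?addr0 //; apply: small;
    last exact: ltn_modpN0.
  have -> : r = (b ^+ k)%:P * W - Q * F by rewrite mul_polyC E addrC addKr.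
  by apply: JB => //; exact: JM.
have [G FG] : exists G, F = b *: G.
  have [k [Q E]] := pseudo _ JU; rewrite mulrC in E.
  exact: mpoly_normal (expf_neq0 k b0) te lU E.
have G1 : G \is monic.
  apply/eqP/(mulfI b0); rewrite mulr1 -lead_coefZ -FG.
  by [].
have sG : size G = size F by rewrite FG size_scale.
(* Since [G] itself is not known to lie in the ideal, the remainder is first multiplied by [b]. *)
have dvdG W : J W -> exists Q, W = Q * G.
  move=> JW; exists (Pdiv.Ring.rdivp W G).
  have E := Pdiv.RingMonic.rdivp_eq G1 W; rewrite {1}E.
  suff -> : Pdiv.Ring.rmodp W G = 0 by rewrite addr0.
  set Q := Pdiv.Ring.rdivp W G in E *; set r := Pdiv.Ring.rmodp W G in E *.
  apply/eqP; have /eqP : b *: r = 0.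
    apply: small; last by rewrite size_scale // -sG Pdiv.Ring.ltn_rmodp
      monic_neq0.
    have -> : b *: r = b%:P * W - Q * F.
      by rewrite E FG mul_polyC scalerDr -scalerAr addrC addKr.
    by apply: JB => //; exact: JM.
  by rewrite scale_poly_eq0 (negbTE b0).
have [H UE] := dvdG _ JU; have [K PE] := dvdG _ JP.
have at0 q x : mev x q = (evp x (shiftp e q)).[0].
  by rewrite evp_shiftp scale0r addr0.
have ev0 P x : (evp x P).[0] = mev x P.[0].
  by rewrite -[X in _.[X]](rmorph0 (mev x)) /evp horner_map.
have lH : lead_coef H = mpolyC n l.
  by rewrite -lU UE lead_coefM (monicP G1) mulr1.
have uE : u = H.[0] * G.[0].
  apply: mev_inj => x; rewrite at0 -/U UE ev0 hornerM; done.
have pE : p = K.[0] * G.[0].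
  by apply: mev_inj => x; rewrite at0 PE ev0 hornerM.
(* If [H] does not depend on [t], it is the constant [l]; then [u] is a constant multiple of [G] at
   [t = 0], which divides [p]. *)
have [sH|sH] := leqP (size H) 1.
  have HE : H.[0] = mpolyC n l.
    by move: lH; rewrite (size1_polyC sH) hornerC lead_coefC.
  exists (l^-1 *: K.[0]); rewrite uE HE pE mul_mpolyC -scalerAr -scalerAl.
  by rewrite scalerA mulVf // scale1r mulrC.
exfalso.
(* Where [b] is nonzero, cancelling [G] in the bound for [F = b G] against [U = H G] shows that
   [H(x, .)] has no real root, so it has the sign of its leading coefficient [l]. *)
have h0 x : 0 <= mev x (l *: H.[0]).
  apply: (mev_ge0_dense b0) => {}x bx.
  have lx : lead_coef (evp x H) = l by rewrite /evp lead_coef_map_eq lH /= mevC.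
  rewrite -mul_mpolyC rmorphM /= mevC -ev0 -{1}lx; apply/ltW/poly_noroot_sign.
  have [T TF] := JF.
  have Gx0 : evp x G != 0.
    by rewrite -lead_coef_eq0 /evp lead_coef_map_eq /= (monicP G1) /mev meval1
      oner_neq0.
  (* Squaring gives a polynomial inequality in [t], which extends across the zeros of [G(x, .)]. *)
  have bound t : 0 <= ((evp x T * evp x H) ^+ 2 - (mev x b ^+ 2)%:P).[t].
    move: t; apply: (poly_ge0_dense Gx0) => t Gt.
    have le : `|mev x b| <= (evp x T).[t] * `|(evp x H).[t]|.
      have := TF x t; rewrite UE FG -mul_polyC !rmorphM /= {1}/evp map_polyC.
      by rewrite !hornerM hornerC /= !normrM mulrA ler_pM2r ?normr_gt0.
    have -> : ((evp x T * evp x H) ^+ 2 - (mev x b ^+ 2)%:P).[t] =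
        ((evp x T).[t] * (evp x H).[t]) ^+ 2 - mev x b ^+ 2.
      by rewrite hornerD hornerN hornerC horner_exp hornerM.
    rewrite subr_ge0 -(real_normK (num_real (mev x b))).
    rewrite -[X in _ <= X]real_normK ?num_real // lerXn2r ?nnegrE //.
    by apply: le_trans le _; rewrite normrM ler_wpM2r // ler_norm.
  move=> t; apply/eqP => Ht; have := bound t.
  rewrite hornerD hornerN hornerC horner_exp hornerM Ht mulr0 expr0n /= sub0r.
  rewrite oppr_ge0 leNgt => /negP; apply.
  by rewrite exprn_even_gt0.
(* Undoing the shift turns [U = H G] into a factorisation of [u], free of [t], so both factors are
   free of [t] and [H(x, t) = c (x + t e)]. *)
have [c cE] : exists c, unshift e H = c%:P.
  have uU : unshift e U = u%:P.
    apply: evp_inj => x t; rewrite evp_unshift evp_shiftp subrK.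
    by rewrite /evp map_polyC hornerC.
  have HG : unshift e H * unshift e G = u%:P by rewrite -rmorphM -UE; exact: uU.
  have un0 : u%:P != 0 by rewrite polyC_eq0.
  have H0 : unshift e H != 0 by apply: contraNneq un0 => H0;
    rewrite -HG H0 mul0r.
  have G0 : unshift e G != 0 by apply: contraNneq un0 => G0;
    rewrite -HG G0 mulr0.
  have sH0 : (0 < size (unshift e H))%N by rewrite size_poly_gt0.
  have sG0 : (0 < size (unshift e G))%N by rewrite size_poly_gt0.
  have := size_mul H0 G0; rewrite HG size_polyC u0 => s1.
  exists (unshift e H)`_0; apply: size1_polyC.
  move: sH0 sG0 s1; move: (size _) (size _) => a b' a0 b0' /=; lia.
have HE x t : (evp x H).[t] = mev (x + t *: e) c.
  by have := evp_unshift e (x + t *: e) t H;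
    rewrite addrK cE /evp map_polyC hornerC.
have cH : c = H.[0].
  by apply: mev_inj => x; rewrite -ev0 HE scale0r addr0.
have H00 : H.[0] != 0 by apply: contraNneq u0 => H00; rewrite uE H00 mul0r.
have G00 : G.[0] != 0 by apply: contraNneq u0 => G00; rewrite uE G00 mulr0.
have sH0 : (1 < mmeasure mdeg H.[0])%N.
  rewrite ltnNge; apply/negP => /msize1_polyC; set k := mcoeff _ _ => kE.
  move: sH; rewrite (_ : H = (mpolyC n k)%:P) ?ltnNge ?size_polyC_leq1 //.
  by apply: evp_inj => x t; rewrite HE cH kE /evp map_polyC hornerC /= !mevC.
(* The product is [l H G^2] at [t = 0], and [G] there has smaller degree than [u] because [H] there
   is not constant. *)
apply: (@harmonic_mul_sign _ _ u (l *: G.[0])) => //.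
- by rewrite mscalerI negb_or te.
- rewrite mmeasureZ // uE msizeM //.
  by rewrite (mpolySpred mdeg G00) addnS /= -[X in (X < _)%N]add1n ltn_add2r.
- move=> x; have := h0 x; rewrite uE -!mul_mpolyC !rmorphM /= !mevC => lH0.
  have -> : mev x H.[0] * mev x G.[0] * (l * mev x G.[0]) =
    l * mev x H.[0] * mev x G.[0] ^+ 2 by ring.
  by rewrite mulr_ge0 // sqr_ge0.
Qed.
End HarmonicDivides.

(** * Degree of the quotient *)

Section Growth.
Variable R : realType.
Implicit Types q w : {poly R}.

Lemma poly_eventually_neq0 w :
  w != 0 -> exists T, forall t, T <= t -> w.[t] != 0.
Proof.
move=> w0; have l0 : lead_coef w != 0 by rewrite lead_coef_eq0.
have l2 : 0 < lead_coef (lead_coef w *: w).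
  by rewrite lead_coefZ -expr2 exprn_even_gt0.
have [T TP] := poly_pinfty_gt_lc l2; exists T => t /TP.
by apply: contraTneq => wt; rewrite hornerZ wt mulr0 -ltNge.
Qed.

(** Multiplying by the leading coefficient [l] makes it positive; subtracting half of the leading
    term still leaves a positive leading coefficient, so [l q] eventually exceeds [l^2 t^d / 2]. *)
Lemma poly_lower_bound q : q != 0 -> exists2 k : R, 0 < k &
  exists T, forall t, T <= t -> k * t ^+ (size q).-1 <= `|q.[t]|.
Proof.
move=> q0; set l := lead_coef q; set d := (size q).-1.
have l0 : l != 0 by rewrite lead_coef_eq0.
have l2 : 0 < l ^+ 2 by rewrite exprn_even_gt0.
have nl : 0 < `|l| by rewrite normr_gt0.
pose s := l *: q - (l ^+ 2 / 2) *: 'X^d.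
have sd : s`_d = l ^+ 2 / 2.
  by rewrite coefB !coefZ coefXn eqxx mulr1 -[q`_d]/l; field.
have ss : size s = d.+1.
  have dq : size q = d.+1 by rewrite prednK // size_poly_gt0.
  apply/eqP; rewrite eqn_leq; apply/andP; split.
    apply: leq_trans (size_polyD _ _) _; rewrite geq_max size_polyN.
    rewrite (leq_trans (size_scale_leq _ _)) ?dq //=.
    by rewrite (leq_trans (size_scale_leq _ _)) // size_polyXn.
  rewrite ltnNge; apply/negP => /(nth_default 0) s0.
  by move: sd; rewrite s0 => /esym/eqP;
    rewrite mulf_eq0 invr_eq0 pnatr_eq0 orbF gt_eqF.
have ls : 0 < lead_coef s by rewrite lead_coefE ss /= sd; lra.
have [T TP] := poly_pinfty_gt_lc ls.
exists (`|l| / 2); first by rewrite divr_gt0.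
exists T => t /TP; move/(lt_le_trans ls).
rewrite hornerD hornerN !hornerZ hornerXn subr_gt0 => H.
have : l * q.[t] <= `|l| * `|q.[t]| by rewrite -normrM ler_norm.
move=> /(lt_le_trans H); rewrite -(real_normK (num_real l)) expr2 -mulrA -mulrA.
by rewrite ltr_pM2l // mulrA => /ltW.
Qed.

Lemma poly_growth_degree q w (K gamma : R) : q != 0 -> w != 0 ->
  (forall t, 1 <= t -> w.[t] != 0 -> `|q.[t]| <= K * t `^ gamma) ->
  (size q).-1%:R <= gamma.
Proof.
move=> q0 w0 qK; rewrite leNgt; apply/negP => gd.
have [k k0 [T TP]] := poly_lower_bound q0.
have [T' T'P] := poly_eventually_neq0 w0.
set d := (size q).-1 in gd TP; pose del := d%:R - gamma.
have del0 : 0 < del by rewrite subr_gt0.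
(* Then [k * M > K], while [t] below is chosen with [M <= t^del]; this contradicts the upper bound
   on [q]. *)
pose M := `|K| / k + 1.
have M0 : 0 < M by rewrite ltr_wpDl // divr_ge0 // ltW.
pose t := Num.max (Num.max T T') (Num.max 1 (M `^ del^-1)).
have tT : T <= t by rewrite !le_max lexx.
have tT' : T' <= t by rewrite !le_max lexx orbT.
have t1 : 1 <= t by rewrite !le_max lexx !orbT.
have tM : M `^ del^-1 <= t by rewrite !le_max lexx !orbT.
have t0 : 0 < t by exact: lt_le_trans t1.
have Mt : M <= t `^ del.
  rewrite -[X in X <= _](powRr1 (ltW M0)) -(mulVf (lt0r_neq0 del0)) powRrM.
  by apply: ge0_ler_powR; rewrite ?nnegrE ?powR_ge0 // ltW.
have := qK t t1 (T'P t tT'); move=> /(le_trans (TP t tT)).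
have -> : t ^+ d = t `^ del * t `^ gamma.
  rewrite -powRD; first by rewrite /del subrK powR_mulrn // ltW.
  by rewrite (gt_eqF t0) implybT.
rewrite mulrA ler_pM2r ?powR_gt0 // => kK.
have : k * M <= K by apply: le_trans kK; rewrite ler_pM2l.
rewrite /M mulrDr mulr1 mulrCA divff ?mulr1; last by rewrite gt_eqF.
by have := ler_norm K; lra.
Qed.
End Growth.

(** * Passage from the analytic hypotheses to polynomials *)

Section Assembly.
Variables (R : realType) (n : nat).
Implicit Types (x e : 'rV[R]_n) (p u : mpoly n R).

Lemma mpoly_fun_harmonic u : is_harmonic (mpoly_fun u) -> mlap u = 0.
Proof.
move=> [_ lu]; apply: mev_eq0 => x; rewrite -[RHS](lu x) /laplacian.
rewrite /mlap (rmorph_sum (mev x)) /=; apply: eq_bigr => i _.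
have pE p : partial i (mpoly_fun p) = mpoly_fun (mderiv i p).
  apply/funext => y.
  exact: (@derive_val _ _ _ _ _ _ _ (is_derive_mev i y p)).
by rewrite !pE.
Qed.

Lemma euclidean_norm_le x : euclidean_norm x <= n%:R * `|x|.
Proof.
have nx : 0 <= n%:R * `|x| by rewrite mulr_ge0.
rewrite -(ger0_norm nx) -sqrtr_sqr; apply: ler_wsqrtr.
apply: (@le_trans _ _ (\sum_(i < n) `|x| ^+ 2)).
  apply: ler_sum => i _; rewrite -(real_normK (num_real (x ord0 i))).
  by rewrite lerXn2r ?nnegrE // coord_le_norm.
rewrite sumr_const card_ord exprMn -[X in X <= _]mulr_natl ler_wpM2r ?sqr_ge0
  //.
by rewrite -natrX ler_nat; case: (n) => // m; rewrite leq_pmulr.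
Qed.

Lemma euclidean_norm_sqr x : euclidean_norm x ^+ 2 = mev x (\sum_i var i ^+ 2).
Proof.
rewrite /euclidean_norm sqr_sqrtr; last by apply: sumr_ge0 => i _;
  exact: sqr_ge0.
rewrite (rmorph_sum (mev x)) /=; apply: eq_bigr => i _.
by rewrite rmorphXn /= mevX.
Qed.

Lemma euclidean_normZ (t : R) e : 0 <= t ->
  euclidean_norm (t *: e) = t * euclidean_norm e.
Proof.
move=> t0; rewrite /euclidean_norm -[t in RHS](ger0_norm t0) -sqrtr_sqr.
rewrite -sqrtrM ?sqr_ge0 // mulr_sumr; congr Num.sqrt.
by apply: eq_bigr => i _; rewrite mxE exprMn.
Qed.
End Assembly.

Theorem theorem1p2 (R : realType) (n : nat) (n_ge2 : (2 <= n)%N)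
    (u : mpoly.mpoly n R) (v : 'rV[R]_n -> R)
    (u_harmonic : is_harmonic (mpoly_fun u))
    (u_neq0 : exists x, mpoly_fun u x != 0)
    (v_harmonic : is_harmonic v)
    (zero_sub : zero_set (mpoly_fun u) `<=` zero_set v)
    (gamma C : R) (gamma_ge0 : 0 <= gamma) (C_gt0 : 0 < C)
    (growth : forall x, ~ zero_set (mpoly_fun u) x ->
      `|v x / mpoly_fun u x| <= C * (1 + euclidean_norm x) `^ gamma) :
  is_polynomial_ratio v (mpoly_fun u) (Num.floor gamma).
Proof.
have lap_u := mpoly_fun_harmonic u_harmonic.
have u0 : u != 0.
  by case: u_neq0 => x; apply: contraNneq => ->; rewrite /mpoly_fun meval0.
have en0 (x : 'rV[R]_n) : 0 <= euclidean_norm x by exact: sqrtr_ge0.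
(* An integer exponent is enough for polynomiality and divisibility; the exact [gamma] returns only
   in the degree bound. *)
pose N := Num.bound gamma.
have powN (x : 'rV[R]_n) :
    (1 + euclidean_norm x) `^ gamma <= (1 + euclidean_norm x) ^+ N.
  rewrite -powR_mulrn ?addr_ge0 //; apply: ler_powR; first by rewrite lerDl.
  exact/ltW/archi_boundP.
(* At the zeros of [u], where the ratio is not controlled, the inclusion of zero sets makes both
   sides 0. *)
have vu x : `|v x| <= C * (1 + euclidean_norm x) ^+ N * `|mev x u|.
  have C0 := ltW C_gt0.
  have [ux|ux] := eqVneq (mev x u) 0.
    rewrite (zero_sub x ux) normr0 mulr_ge0 // mulr_ge0 // exprn_ge0 //.
    by rewrite addr_ge0.
  have := growth x (fun e => negP ux (introT eqP e)).
  rewrite normrM normfV ler_pdivrMr ?normr_gt0 // => /le_trans; apply.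
  by rewrite ler_wpM2r // ler_pM2l.
have [Cu Cu0 [Nu uB]] := mev_bound u.
have [p vp] : exists p, forall x, v x = mev x p.
  have [cv lv] := is_harmonic_laplacian v_harmonic.
  apply: (@liouville _ _ v (N + Nu) (C * (n%:R + 1) ^+ N * Cu)) => //.
    by rewrite !mulr_gt0 ?exprn_gt0 // ltr_wpDl.
  move=> x; apply: (le_trans (vu x)).
  have -> : C * (n%:R + 1) ^+ N * Cu * (1 + `|x|) ^+ (N + Nu) =
      C * ((n%:R + 1) * (1 + `|x|)) ^+ N * (Cu * (1 + `|x|) ^+ Nu).
    by rewrite exprMn exprD; ring.
  apply: ler_pM => //.
    by rewrite mulr_ge0 ?(ltW C_gt0) // exprn_ge0 // addr_ge0.
  rewrite ler_pM2l // lerXn2r ?nnegrE ?addr_ge0 ?mulr_ge0 ?addr_ge0 //.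
  have := euclidean_norm_le x; have : 0 <= `|x| by [].
  have : 0 <= n%:R :> R by [].
  by lra.
have [r pr] : exists r, p = u * r.
  (* The dominating factor has to be a polynomial, and [1 + |x| <= 2 + |x|^2]. *)
  apply: (harmonic_divides (h := C *: (2 + \sum_i var i ^+ 2) ^+ N)) => // x.
  rewrite -vp; apply: (le_trans (vu x)); rewrite ler_wpM2r //.
  rewrite -mul_mpolyC rmorphM /= mevC ler_pM2l // rmorphXn rmorphD /=.
  rewrite -euclidean_norm_sqr -[2]mpolyC_nat mevC.
  rewrite lerXn2r ?nnegrE ?addr_ge0 ?sqr_ge0 //.
  have := en0 x; set a := euclidean_norm x => a0.
  have : 0 <= (a - 1) ^+ 2 by exact: sqr_ge0.
  by rewrite !expr2; nra.
exists r; split=> [x|]; first by rewrite vp pr; exact: (rmorphM (mev x)).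
have [->|r0] := eqVneq r 0.
  by rewrite mmeasure0 addr_ge0 // floor_ge0.
have tops : top u * top r != 0 by rewrite mulf_neq0 // top_neq0.
have [e te] := mev_neq0 tops.
move: te; rewrite rmorphM /= mulf_eq0 negb_or => /andP[tu tr].
(* One direction serves both polynomials: along it [r] keeps its full degree and [u] does not vanish
   identically. *)
have lead0 q : mev e (top q) != 0 ->
    evp 0 (shiftp e q) != 0 /\ size (evp 0 (shiftp e q)) = mmeasure mdeg q.
  move=> /[dup] tq /shiftp_lead [sq lq].
  have sE : size (evp 0 (shiftp e q)) = size (shiftp e q).
    by rewrite /evp size_map_poly_id0 // lq /= mevC.
  split; last by rewrite sE.
  by rewrite -size_poly_gt0 sE size_poly_gt0 -lead_coef_eq0 lq mpolyC_eq0.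
have [w0 _] := lead0 u tu; have [q0 sq] := lead0 r tr.
have deg : (mmeasure mdeg r).-1%:R <= gamma.
  rewrite -sq; apply: (poly_growth_degree
    (K := C * (1 + euclidean_norm e) `^ gamma) q0 w0) => t t1.
  have t0 : 0 <= t by lra.
  rewrite !evp_shiftp add0r => ute.
  have := growth (t *: e) (fun E => negP ute (introT eqP E)).
  have -> : v (t *: e) / mpoly_fun u (t *: e) = mev (t *: e) r.
    rewrite vp pr rmorphM mulrAC.
    by rewrite -[mpoly_fun u _]/(mev (t *: e) u) divff // mul1r.
  move=> /le_trans; apply; rewrite -mulrA ler_pM2l // -powRM ?addr_ge0 //.
  apply: ge0_ler_powR => //; rewrite ?nnegrE ?mulr_ge0 ?addr_ge0 //.
  by rewrite euclidean_normZ // mulrDl mul1r lerD // mulrC.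
rewrite (mpolySpred mdeg r0) -addn1 PoszD lerD2r floor_ge_int.
exact: deg.
Qed.
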